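(* Let $r\in\{0,1,2,\dots\}$ be fixed, and let $B>0$ and $c>0$ be the constants of Ramachandra's inequality for this $r$ (see context). Then for all sufficiently large $T$ (i.e. as $T\to\infty$) and all $U\in\left[3\ln^c T,\frac{T}{\ln T}\right]$ the following holds: if $\mathring{T}<\mathring{\widehat{T+U}}$ are such that $\varphi_1$ maps the segment $[\mathring{T},\mathring{\widehat{T+U}}]$ onto $[T,T+U]$, i.e. $$\varphi_1\left\{\left[\mathring{T},\mathring{\widehat{T+U}}\right]\right\}=[T,T+U],$$ then $$\int_{\mathring{T}}^{\mathring{\widehat{T+U}}}\left|\zeta^{(r)}\left(\frac12+i\varphi_1(t)\right)\right|\left|\zeta\left(\frac12+it\right)\right|^2dt>\frac{B}{2}\,U(\ln U)^{r+\frac14}\ln T .$$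
   Context: $\zeta$ is the Riemann zeta-function, $\zeta^{(r)}$ its $r$-th derivative (with $\zeta^{(0)}=\zeta$), and $\ln^c T=(\ln T)^c$. Jacob's ladder. Let $Z(t)=e^{i\vartheta(t)}\zeta\left(\frac12+it\right)$ with $\vartheta(t)=-\frac t2\ln\pi+\operatorname{Im}\ln\Gamma\left(\frac14+i\frac t2\right)$, so $|Z(t)|=\left|\zeta\left(\frac12+it\right)\right|$ for real $t$. Let $\mu$ be a fixed function with $\mu(y)\ge 7y\ln y$. The Jacob's ladder $\varphi(T)=\varphi_\mu(T)$ is the exact solution $x(T)=\varphi(T)$ of the nonlinear integral equation $$\int_0^{\mu[x(T)]}Z^2(t)e^{-\frac{2}{x(T)}t}\,dt=\int_0^T Z^2(t)\,dt .$$ Put $\varphi_1(t)=\frac12\varphi(t)$, also called a Jacob's ladder. It is defined for all sufficiently large $t\ge T_0[\varphi]$ and satisfies (standing fact) $$\frac{d\varphi_1(t)}{dt}=\frac{\left|\zeta\left(\frac12+it\right)\right|^2}{\left\{1+O\left(\frac{\ln\ln t}{\ln t}\right)\right\}\ln t},\qquad t\to\infty .$$ Constants $B,c$ (Ramachandra's inequality). For every fixed $r\in\{0,1,2,\dots\}$ there are constants $B>0$ and $c>0$ such that for all sufficiently large $T$ and all $U$ with $3\ln^cT\le U\le 2T$, $$\int_T^{T+U}\left|\zeta^{(r)}\left(\frac12+it\right)\right|dt>B\,U(\ln U)^{r+\frac14}.$$ The $B$ and $c$ in the claim are these constants. *)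

(* Defs.v *)
From Stdlib Require Import Reals Factorial Lra.
From Coquelicot Require Import Coquelicot.
Open Scope R_scope.

Definition Cexp (z : C) : C :=
  (exp (Re z) * cos (Im z), exp (Re z) * sin (Im z)).

(* x ^ s = e^(s ln x); meaningful for x > 0 only. *)
Definition Rcpow (x : R) (s : C) : C := Cexp (s * RtoC (ln x))%C.

(* The principal logarithm, on the half-plane Re z > 0 only. *)
Definition Clog (z : C) : C := (ln (Cmod z), atan (Im z / Re z)).

Definition C_lim_seq (u : nat -> C) : C :=
  (real (Lim_seq (fun n => Re (u n))), real (Lim_seq (fun n => Im (u n)))).

(* The analytic continuation of sum n^(-s) to Re s > 0, s <> 1, as
     zeta s = lim_N ( sum_(1 <= n <= N) n^(-s) - N^(1-s) / (1-s) )
   (Euler-Maclaurin summation: for Re s > 0 the limit is locally uniform, and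
   for Re s > 1 the second term vanishes in the limit, see [zeta_dirichlet]).
   Here N is shifted by one.  The value is not meaningful for Re s <= 0. *)
Definition zeta (s : C) : C :=
  C_lim_seq (fun N =>
    sum_n (fun n => Rcpow (INR (S n)) (- s)) N
    - Rcpow (INR (S N)) (1 - s) / (1 - s))%C.

(* [C_derive] is a total operator; it is the complex derivative wherever the
   latter exists ([is_C_derive_unique]). *)
Definition zeta_deriv (r : nat) : C -> C := Nat.iter r C_derive zeta.

Definition critical_point (t : R) : C := (1 / 2, t).

(* The branch of ln Gamma on Re z > 0 that is real on the positive real axis:
   the logarithm of Gauss's formula
     Gamma z = lim_n  n^z n! / (z (z+1) ... (z+n)),
   every factor z+k having positive real part. *)
Definition ln_Gamma (z : C) : C :=
  C_lim_seq (fun n =>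
    z * RtoC (ln (INR n)) + RtoC (ln (INR (fact n)))
    - sum_n (fun k => Clog (z + RtoC (INR k))) n)%C.

Definition vartheta (t : R) : R :=
  - (t / 2) * ln PI + Im (ln_Gamma (1 / 4, t / 2)).

Definition hardy_Z (t : R) : C :=
  (Cexp (0, vartheta t) * zeta (critical_point t))%C.

(* [mu] is a function on [y0, +oo[ and [phi] a function from [T0, +oo[ to
   [y0, +oo[; the values of the total functions outside these ranges are
   irrelevant.  The integrals are integrals of complex-valued functions, since
   that Z is real-valued is a theorem (the functional equation). *)
Definition is_jacob_ladder (mu : R -> R) (y0 : R) (phi : R -> R) (T0 : R) : Prop :=
  0 < y0 /\
  (forall y : R, y0 <= y -> 7 * y * ln y <= mu y) /\
  (forall T : R, T0 <= T ->
     y0 <= phi T /\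
     RInt (V := C_R_CompleteNormedModule)
       (fun t => (hardy_Z t ^ 2 * RtoC (exp (- (2 / phi T) * t)))%C)
       0 (mu (phi T))
     = RInt (V := C_R_CompleteNormedModule)
       (fun t => (hardy_Z t ^ 2)%C) 0 T).

Definition ladder1 (phi : R -> R) (t : R) : R := phi t / 2.

(* phi_1 is differentiable on its domain [T0, +oo[, and
   phi_1'(t) = |zeta(1/2+it)|^2 / ((1 + O(ln ln t / ln t)) ln t), t -> +oo;
   [eps] is the O-term, with implied constant [K]. *)
Definition ladder_derivative_formula (phi : R -> R) (T0 : R) : Prop :=
  (forall t : R, T0 <= t -> ex_derive (ladder1 phi) t) /\
  exists (eps : R -> R) (K T1 : R), forall t : R, T1 <= t ->
    Rabs (eps t) <= K * (ln (ln t) / ln t) /\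
    Derive (ladder1 phi) t
      = Cmod (zeta (critical_point t)) ^ 2 / ((1 + eps t) * ln t).

Definition ramachandra_inequality (r : nat) (B c : R) : Prop :=
  exists T1 : R, forall T U : R, T1 <= T ->
    3 * Rpower (ln T) c <= U <= 2 * T ->
    RInt (fun t => Cmod (zeta_deriv r (critical_point t))) T (T + U)
      > B * U * Rpower (ln U) (INR r + 1 / 4).

Definition maps_segment_onto (f : R -> R) (a b a' b' : R) : Prop :=
  forall y : R, (exists t : R, a <= t <= b /\ f t = y) <-> a' <= y <= b'.

Lemma Cmod_Cexp (z : C) : Cmod (Cexp z) = exp (Re z).
Proof.
unfold Cmod, Cexp; simpl.
replace (_ + _) with (exp (Re z) ^ 2).
  apply sqrt_pow2, Rlt_le, exp_pos.
generalize (sin2_cos2 (Im z)); unfold Rsqr; intros H.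
replace (exp (Re z) ^ 2)
  with (exp (Re z) ^ 2 * (sin (Im z) * sin (Im z) + cos (Im z) * cos (Im z))).
  ring.
rewrite H; ring.
Qed.

Lemma C_lim_seq_unique (u : nat -> C) (l : C) :
  filterlim u eventually (locally (T := C_UniformSpace) l) -> C_lim_seq u = l.
Proof.
intros H; destruct l as [a b]; unfold C_lim_seq.
assert (Ha : is_lim_seq (fun n => Re (u n)) a).
  apply (filterlim_comp _ _ _ u fst _ _ _ H).
  apply (continuous_fst (U := R_UniformSpace) (V := R_UniformSpace)).
assert (Hb : is_lim_seq (fun n => Im (u n)) b).
  apply (filterlim_comp _ _ _ u snd _ _ _ H).
  apply (continuous_snd (U := R_UniformSpace) (V := R_UniformSpace)).
now rewrite (is_lim_seq_unique _ _ Ha), (is_lim_seq_unique _ _ Hb).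
Qed.

Lemma zeta_dirichlet (s L : C) :
  1 < Re s ->
  is_series (V := C_R_NormedModule) (fun n => Rcpow (INR (S n)) (- s)) L ->
  zeta s = L.
Proof.
intros Hs HL; apply C_lim_seq_unique.
assert (Hs0 : (1 - s)%C <> 0%C).
  intros E; apply (f_equal Re) in E; simpl in E.
  destruct s as [x y]; simpl in *; lra.
assert (H0 : filterlim (fun N : nat => (- (Rcpow (INR (S N)) (1 - s) / (1 - s)))%C)
               eventually (locally (T := C_R_NormedModule) (zero : C_R_NormedModule))).
  apply (filterlim_norm_zero (K := R_AbsRing) (V := C_R_NormedModule)).
  apply (is_lim_seq_ext
           (fun n => / Cmod (1 - s) * exp ((1 - Re s) * ln (INR (S n)))) _ 0).
    intros n; symmetry.
    etransitivity; [symmetry; apply Cmod_norm |].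
    rewrite Cmod_opp, Cmod_div by exact Hs0; unfold Rcpow; rewrite Cmod_Cexp.
    unfold Rdiv; rewrite Rmult_comm; do 2 f_equal.
    destruct s as [x y]; simpl; ring.
  replace (Finite 0) with (Rbar_mult (/ Cmod (1 - s)) 0)
    by (simpl; f_equal; ring).
  apply is_lim_seq_scal_l.
  apply (is_lim_comp_seq exp _ m_infty 0 is_lim_exp_m).
    now exists 0%nat.
  replace m_infty with (Rbar_mult (1 - Re s) p_infty).
    apply is_lim_seq_scal_l.
    apply (is_lim_comp_seq ln _ p_infty p_infty is_lim_ln_p).
      now exists 0%nat.
    apply (is_lim_seq_incr_1 INR), is_lim_seq_INR.
  apply is_Rbar_mult_unique, is_Rbar_mult_sym, is_Rbar_mult_p_infty_neg.
  simpl; lra.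
replace L with (plus (G := C_R_NormedModule) L zero) by apply plus_zero_r.
apply (filterlim_comp_2 _ _ (plus (G := C_R_NormedModule)) HL H0).
apply (filterlim_plus (K := R_AbsRing) (V := C_R_NormedModule) L zero).
Qed.

(* Main.v *)
Require Import Defs.
From Stdlib Require Import Reals Lra Lia.
From Coquelicot Require Import Coquelicot.
Open Scope R_scope.

(** Put [w t = |zeta(1/2+it)|^2] and [F y = |zeta^(r)(1/2+iy)|].  The ladder
    [phi_1] satisfies [phi_1' = w / ((1 + eps) ln t)], so on [[a, b]] the
    integrand [F (phi_1 t) * w t] equals [F (phi_1 t) * phi_1' t] times a factor
    close to [ln t].  If that factor is at least [ln T / 2] throughout [[a, b]],
    the substitution [y = phi_1 t] bounds the integral below by
    [ln T / 2] times the integral of [F] over [[T, T + U]], and Ramachandra's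
    inequality finishes the proof.

    The factor must therefore be compared with [ln T = ln (phi_1 a)]: since
    [eps] tends to 0, it suffices that [ln (phi_1 a) <= theta * ln a] for a
    constant [theta < 2] and large [a], which follows from
    [phi_1 a = O(a^theta')] with [theta' < theta].  The trivial bound [zeta(1/2+it) = O(t^(1/2))] with [phi_1' <= w] gives only
    [theta' = 2], so a power saving is required, and any mean-value bound with
    such a saving will do.  Comparing [zeta] with the Dirichlet polynomial of
    length [N] (first-order Euler-Maclaurin, error [O(t / sqrt N)]) and squaring
    out the polynomial, a function whose derivative is at most [w] grows by at
    most [O(N^(3/2) + a sqrt N + a^3 / N)] up to [a]; the choice [N ~ a^(6/5)]
    gives [theta' = 9/5] ([growth_bound]), which leads to [ladder_ln_bound].

    The substitution is made with primitives rather than integrals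
    ([RInt_comp_ge]): [phi_1'] is only known to exist, it need not be
    continuous or integrable, but the difference between the two sides, as a
    function of the upper bound, is differentiable with nonnegative derivative.

    This needs [F] and [w] to be continuous, hence the continuity on the
    critical line of every derivative of [zeta], which is defined here as a
    limit.  On the strip [0 < Re s < 1] one has
    [zeta s * (1 - 2^(1-s)) = sum ((2n+1)^(-s) - (2n+2)^(-s))].  The terms of this
    paired series and all their derivatives in [s] are
    [O(n^(-1-delta))] locally uniformly, so the sum can be differentiated term
    by term indefinitely, and [1 - 2^(1-s)] has no zero there
    ([zeta_smooth], [zeta_deriv_continuous]). *)

(** * Mean-value bounds for real functions and plane curves *)

Lemma Cmod_le_Rabs (z : C) : Cmod z <= Rabs (Re z) + Rabs (Im z).
Proof.
replace z with (RtoC (Re z) + (0, Im z))%C at 1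
  by (destruct z; unfold Cplus, RtoC; simpl; f_equal; ring).
eapply Rle_trans; [apply Cmod_triangle|].
rewrite Cmod_R; apply Rplus_le_compat_l.
replace (0, Im z)%C with (Ci * RtoC (Im z))%C
  by (unfold Cmult, RtoC, Ci; simpl; f_equal; ring).
rewrite Cmod_mult, Cmod_R, Cmod_Ci; lra.
Qed.

Lemma Rabs_Re_le (z : C) : Rabs (Re z) <= Cmod z.
Proof. eapply Rle_trans; [apply Rmax_l|apply Rmax_Cmod]. Qed.

Lemma Rabs_Im_le (z : C) : Rabs (Im z) <= Cmod z.
Proof. eapply Rle_trans; [apply Rmax_r|apply Rmax_Cmod]. Qed.

Lemma Re_ge_sub_Cmod (s z : C) : Re s - Cmod (z - s) <= Re z.
Proof.
assert (H := Rabs_Re_le (z - s)%C).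
replace (Re (z - s)) with (Re z - Re s) in H by reflexivity.
apply Rabs_le_between in H; lra.
Qed.

Lemma mean_value_bound (f df : R -> R) (a b M : R) :
  a <= b ->
  (forall t, a <= t <= b -> is_derive f t (df t) /\ Rabs (df t) <= M) ->
  Rabs (f b - f a) <= M * (b - a).
Proof.
intros Hab H.
destruct (MVT_gen f a b df) as [c [Hc E]].
- intros x; rewrite Rmin_left, Rmax_right by lra; intros Hx; apply H; lra.
- intros x; rewrite Rmin_left, Rmax_right by lra; intros Hx.
  apply derivable_continuous_pt; exists (df x); apply is_derive_Reals, H; lra.
- rewrite Rmin_left, Rmax_right in Hc by lra.
  rewrite E, Rabs_mult, (Rabs_right (b - a)) by lra.
  apply Rmult_le_compat_r; [lra|]; apply H; lra.
Qed.

Lemma nondecreasing_of_derive (f df : R -> R) (a b : R) :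
  a <= b ->
  (forall t, a <= t <= b -> is_derive f t (df t) /\ 0 <= df t) ->
  f a <= f b.
Proof.
intros Hab H.
destruct (MVT_gen f a b df) as [c [Hc E]].
- intros x; rewrite Rmin_left, Rmax_right by lra; intros Hx; apply H; lra.
- intros x; rewrite Rmin_left, Rmax_right by lra; intros Hx.
  apply derivable_continuous_pt; exists (df x); apply is_derive_Reals, H; lra.
- rewrite Rmin_left, Rmax_right in Hc by lra.
  assert (0 <= df c * (b - a)) by (apply Rmult_le_pos; [apply H; lra|lra]).
  lra.
Qed.

(** Componentwise, so that the one-variable real mean value theorem applies;
    passing from components back to the modulus costs a factor 2. *)
Definition curve_derive (f : R -> C) (t : R) (l : C) : Prop :=
  is_derive (fun u => Re (f u)) t (Re l) /\
  is_derive (fun u => Im (f u)) t (Im l).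

Lemma curve_derive_scal (c : C) (f : R -> C) (t : R) (l : C) :
  curve_derive f t l -> curve_derive (fun u => c * f u)%C t (c * l)%C.
Proof.
destruct c as [p q]; intros [D1 D2]; split.
- apply (is_derive_minus (fun u => p * Re (f u)) (fun u => q * Im (f u)));
    [apply (is_derive_scal (fun u => Re (f u)))|apply (is_derive_scal (fun u => Im (f u)))];
    assumption.
- apply (is_derive_plus (fun u => p * Im (f u)) (fun u => q * Re (f u)));
    [apply (is_derive_scal (fun u => Im (f u)))|apply (is_derive_scal (fun u => Re (f u)))];
    assumption.
Qed.

Lemma curve_mean_value_bound (f df : R -> C) (a b M : R) :
  a <= b ->
  (forall t, a <= t <= b -> curve_derive f t (df t) /\ Cmod (df t) <= M) ->
  Cmod (f b - f a) <= 2 * M * (b - a).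
Proof.
intros Hab H.
eapply Rle_trans; [apply Cmod_le_Rabs|].
assert (H1 : Rabs (Re (f b) - Re (f a)) <= M * (b - a)).
  apply (mean_value_bound (fun t => Re (f t)) (fun t => Re (df t))); [lra|].
  intros t Ht; destruct (H t Ht) as [[D _] L]; split; [exact D|].
  eapply Rle_trans; [apply Rabs_Re_le|exact L].
assert (H2 : Rabs (Im (f b) - Im (f a)) <= M * (b - a)).
  apply (mean_value_bound (fun t => Im (f t)) (fun t => Im (df t))); [lra|].
  intros t Ht; destruct (H t Ht) as [[_ D] L]; split; [exact D|].
  eapply Rle_trans; [apply Rabs_Im_le|exact L].
replace (Re (f b - f a)) with (Re (f b) - Re (f a)) by (simpl; unfold Re; ring).
replace (Im (f b - f a)) with (Im (f b) - Im (f a)) by (simpl; unfold Im; ring).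
lra.
Qed.

(** The mean-value bound is used twice: for [f1] on [[0, t]], then for
    [f t - t f1(0)] on [[0, 1]]. *)
Lemma curve_taylor_bound (f f1 f2 : R -> C) (M : R) :
  (forall t, 0 <= t <= 1 ->
     curve_derive f t (f1 t) /\ curve_derive f1 t (f2 t) /\ Cmod (f2 t) <= M) ->
  Cmod (f 1 - f 0 - f1 0) <= 4 * M.
Proof.
intros H.
replace (f 1 - f 0 - f1 0)%C
  with ((f 1 - RtoC 1 * f1 0) - (f 0 - RtoC 0 * f1 0))%C
  by (apply injective_projections; simpl; ring).
replace (4 * M) with (2 * (2 * M) * (1 - 0)) by ring.
apply (curve_mean_value_bound (fun t => f t - RtoC t * f1 0)%C
         (fun t => f1 t - f1 0)%C); [lra|].
intros t Ht; destruct (H t Ht) as [[D1 D2] [[E1 E2] L]]; split.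
- split; simpl.
  + apply (is_derive_minus (fun u => Re (f u))
      (fun u => u * fst (f1 0) - 0 * snd (f1 0))); [exact D1|].
    auto_derive; [easy|unfold Re; ring].
  + apply (is_derive_minus (fun u => Im (f u))
      (fun u => u * snd (f1 0) + 0 * fst (f1 0))); [exact D2|].
    auto_derive; [easy|unfold Im; ring].
- replace (2 * M) with (2 * M * 1) by ring.
  assert (0 <= M) by (eapply Rle_trans; [apply Cmod_ge_0|exact L]).
  eapply Rle_trans.
  + apply (curve_mean_value_bound f1 f2 0 t M); [lra|].
    intros u Hu; destruct (H u) as [_ [? ?]]; [lra|now split].
  + rewrite Rminus_0_r; apply Rmult_le_compat_l; lra.
Qed.

(** * The functions (- ln x)^k x^(-s) *)

(** The [k]-th derivative of [x^(-s)] with respect to [s]. *)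
Definition power_deriv (k : nat) (x : R) (s : C) : C :=
  (RtoC ((- ln x) ^ k) * Rcpow x (- s))%C.

Lemma Cmod_dterm (k : nat) (x : R) (s : C) :
  1 <= x -> Cmod (power_deriv k x s) = ln x ^ k * exp (- Re s * ln x).
Proof.
intros Hx; unfold power_deriv; rewrite Cmod_mult, Cmod_R.
assert (0 <= ln x) by (rewrite <- ln_1; apply ln_le; lra).
rewrite <- RPow_abs, Rabs_Ropp, (Rabs_right (ln x)) by lra.
unfold Rcpow; rewrite Cmod_Cexp; do 2 f_equal.
simpl; unfold Re; ring.
Qed.

Lemma power_deriv_polar (k : nat) (x : R) (s : C) :
  power_deriv k x s =
    ((- ln x) ^ k * (exp (- (Re s * ln x)) * cos (Im s * ln x)),
     - ((- ln x) ^ k * (exp (- (Re s * ln x)) * sin (Im s * ln x)))).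
Proof.
destruct s as [a b]; unfold power_deriv, Rcpow, Cexp, Re, Im; simpl.
replace (- a * ln x - - b * 0) with (- (a * ln x)) by ring.
replace (- a * 0 + - b * ln x) with (- (b * ln x)) by ring.
rewrite cos_neg, sin_neg; unfold Cmult; simpl; f_equal; ring.
Qed.

Lemma power_deriv_derive_exponent (k : nat) (x : R) (s w : C) (u : R) :
  curve_derive (fun u => power_deriv k x (s + RtoC u * w)%C) u
               (w * power_deriv (S k) x (s + RtoC u * w))%C.
Proof.
destruct s as [a b], w as [p q]; split.
- eapply is_derive_ext; [intros t; rewrite power_deriv_polar; reflexivity|].
  rewrite power_deriv_polar; unfold Re, Im; simpl; auto_derive; [easy|].
  unfold Rminus; ring.
- eapply is_derive_ext; [intros t; rewrite power_deriv_polar; reflexivity|].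
  rewrite power_deriv_polar; unfold Re, Im; simpl; auto_derive; [easy|].
  unfold Rminus; ring.
Qed.

Lemma power_deriv_derive_base (k : nat) (x : R) (s : C) :
  0 < x ->
  curve_derive (fun x => power_deriv k x s) x
    (- ((RtoC (INR k) * power_deriv (pred k) x s + s * power_deriv k x s) * RtoC (/ x)))%C.
Proof.
intros Hx; destruct s as [a b]; split;
  (eapply is_derive_ext; [intros t; rewrite power_deriv_polar; reflexivity|]);
  rewrite 2!power_deriv_polar; unfold Re, Im; simpl; (auto_derive; [easy|]); ring.
Qed.

(** Complex differentiability with a quadratic remainder.  For analytic
    functions this is no loss, and unlike the little-o form it sums over a series
    under a mere domination hypothesis. *)
Definition cdiff (f : C -> C) (s l : C) : Prop :=
  exists d M : R, 0 < d /\ 0 <= M /\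
    forall w, Cmod w < d -> Cmod (f (s + w) - f s - w * l)%C <= M * Cmod w ^ 2.

(** Taylor's bound along the segment from [s] to [s + w], on which [G0], [G1],
    [G2] are successive complex derivatives. *)
Lemma analytic_taylor_bound (G0 G1 G2 : C -> C) (s w : C) (M : R) :
  (forall u, curve_derive (fun u => G0 (s + RtoC u * w)%C) u
               (w * G1 (s + RtoC u * w))%C) ->
  (forall u, curve_derive (fun u => G1 (s + RtoC u * w)%C) u
               (w * G2 (s + RtoC u * w))%C) ->
  (forall z, Cmod (z - s) <= Cmod w -> Cmod (G2 z) <= M) ->
  Cmod (G0 (s + w) - G0 s - w * G1 s)%C <= 4 * M * Cmod w ^ 2.
Proof.
intros H0 H1 HM.
replace (4 * M * Cmod w ^ 2) with (4 * (Cmod w * (Cmod w * M))) by ring.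
replace (s + w)%C with (s + RtoC 1 * w)%C by ring.
replace s with (s + RtoC 0 * w)%C at 2 3 by ring.
apply (curve_taylor_bound (fun u => G0 (s + RtoC u * w)%C)
  (fun u => w * G1 (s + RtoC u * w))%C
  (fun u => w * (w * G2 (s + RtoC u * w)))%C).
intros u Hu; split; [apply H0|split].
- apply (curve_derive_scal w (fun u => G1 (s + RtoC u * w)%C)), H1.
- rewrite 2!Cmod_mult; do 2 (apply Rmult_le_compat_l; [apply Cmod_ge_0|]).
  apply HM; replace (s + RtoC u * w - s)%C with (RtoC u * w)%C by ring.
  rewrite Cmod_mult, Cmod_R, Rabs_right by lra.
  rewrite <- (Rmult_1_l (Cmod w)) at 2.
  apply Rmult_le_compat_r; [apply Cmod_ge_0|lra].
Qed.

(** * Term-by-term differentiation of complex series *)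

Definition Csummable (u : nat -> C) : Prop :=
  ex_series (fun n => Re (u n)) /\ ex_series (fun n => Im (u n)).

Definition Csum (u : nat -> C) : C :=
  (Series (fun n => Re (u n)), Series (fun n => Im (u n))).

Lemma Csummable_bound (u : nat -> C) (b : nat -> R) :
  ex_series b -> (forall n, Cmod (u n) <= b n) -> Csummable u.
Proof.
intros Hb H; split; apply (ex_series_le (V := R_CompleteNormedModule) _ b); try exact Hb; intros n;
  (eapply Rle_trans; [|apply H]).
- apply Rabs_Re_le.
- apply Rabs_Im_le.
Qed.

Lemma Series_Rabs_bound (a b : nat -> R) :
  ex_series b -> (forall n, Rabs (a n) <= b n) -> Rabs (Series a) <= Series b.
Proof.
intros Hb H.
eapply Rle_trans; [apply Series_Rabs|].
- apply (ex_series_le (V := R_CompleteNormedModule) _ b); [|exact Hb].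
  intros n; unfold norm; simpl; unfold abs; simpl; rewrite Rabs_Rabsolu; apply H.
- apply Series_le; [|exact Hb]; intros n; split; [apply Rabs_pos|apply H].
Qed.

Lemma Cmod_Csum_le (u : nat -> C) (b : nat -> R) :
  ex_series b -> (forall n, Cmod (u n) <= b n) ->
  Cmod (Csum u) <= 2 * Series b.
Proof.
intros Hb H; eapply Rle_trans; [apply Cmod_le_Rabs|]; simpl.
assert (Rabs (Series (fun n => Re (u n))) <= Series b).
  apply Series_Rabs_bound; [exact Hb|]; intros n.
  eapply Rle_trans; [apply Rabs_Re_le|apply H].
assert (Rabs (Series (fun n => Im (u n))) <= Series b).
  apply Series_Rabs_bound; [exact Hb|]; intros n.
  eapply Rle_trans; [apply Rabs_Im_le|apply H].
lra.
Qed.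

Lemma Csum_increment (u v z : nat -> C) (w : C) :
  Csummable u -> Csummable v -> Csummable z ->
  Csum (fun n => u n - v n - w * z n)%C = (Csum u - Csum v - w * Csum z)%C.
Proof.
intros [U1 U2] [V1 V2] [Z1 Z2]; destruct w as [p q].
unfold Csum; apply injective_projections; simpl.
- rewrite (Series_ext _ (fun n =>
    (Re (u n) - Re (v n)) - (p * Re (z n) - q * Im (z n))))
    by (intros n; unfold Re, Im; simpl; ring).
  rewrite !Series_minus, !Series_scal_l;
    try ring; try assumption;
    repeat first [assumption | apply (ex_series_minus (V := R_NormedModule))
                 | apply (ex_series_scal (V := R_NormedModule))].
- rewrite (Series_ext _ (fun n =>
    (Im (u n) - Im (v n)) - (p * Im (z n) + q * Re (z n))))
    by (intros n; unfold Re, Im; simpl; ring).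
  rewrite !Series_minus, !Series_plus, !Series_scal_l;
    try ring; try assumption;
    repeat first [assumption | apply (ex_series_minus (V := R_NormedModule))
                 | apply (ex_series_plus (V := R_NormedModule))
                 | apply (ex_series_scal (V := R_NormedModule))].
Qed.

Definition locally_dominated (f : nat -> C -> C) (s : C) : Prop :=
  exists (d : R) (b : nat -> R), 0 < d /\ ex_series b /\
    forall n z, Cmod (z - s) < d -> Cmod (f n z) <= b n.

(** Summing the quadratic Taylor remainders of the terms, which the dominating
    series of [f2] controls uniformly in [n], gives the quadratic remainder of
    the sum. *)
Lemma Csum_cdiff (f f1 f2 : nat -> C -> C) (s : C) :
  (forall n w u, curve_derive (fun u => f n (s + RtoC u * w)%C) u
                   (w * f1 n (s + RtoC u * w))%C) ->
  (forall n w u, curve_derive (fun u => f1 n (s + RtoC u * w)%C) u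
                   (w * f2 n (s + RtoC u * w))%C) ->
  locally_dominated f s -> locally_dominated f1 s -> locally_dominated f2 s ->
  cdiff (fun z => Csum (fun n => f n z)) s (Csum (fun n => f1 n s)).
Proof.
intros H0 H1 (d0 & b0 & P0 & S0 & B0) (d1 & b1 & P1 & S1 & B1)
  (d2 & b2 & P2 & S2 & B2).
assert (E : Cmod (s - s)%C = 0) by (replace (s - s)%C with (RtoC 0) by ring; apply Cmod_0).
assert (Q : 0 <= Series b2).
  eapply Rle_trans; [apply Rabs_pos|].
  apply (Series_Rabs_bound (fun n => Cmod (f2 n s))); [exact S2|].
  intros n; rewrite Rabs_pos_eq by apply Cmod_ge_0; apply B2; lra.
exists (Rmin d0 (Rmin d1 d2)), (2 * (4 * Series b2)).
split; [repeat apply Rmin_glb_lt; assumption|split; [lra|]].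
intros w Hw.
assert (Hw0 : Cmod w < d0) by (eapply Rlt_le_trans; [exact Hw|apply Rmin_l]).
assert (Hw2 : Cmod w < d2).
  eapply Rlt_le_trans; [exact Hw|].
  eapply Rle_trans; [apply Rmin_r|apply Rmin_r].
rewrite <- Csum_increment.
- replace (2 * (4 * Series b2) * Cmod w ^ 2)
    with (2 * Series (fun n => (4 * Cmod w ^ 2) * b2 n))
    by (rewrite Series_scal_l; ring).
  apply Cmod_Csum_le.
  + apply (ex_series_scal (V := R_NormedModule)); exact S2.
  + intros n; replace (4 * Cmod w ^ 2 * b2 n) with (4 * b2 n * Cmod w ^ 2) by ring.
    apply (analytic_taylor_bound (f n) (f1 n) (f2 n)); [apply H0|apply H1|].
    intros z Hz; apply B2; lra.
- apply (Csummable_bound _ b0); [exact S0|].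
  intros n; apply B0; replace (s + w - s)%C with w by ring; exact Hw0.
- apply (Csummable_bound _ b0); [exact S0|].
  intros n; apply B0; lra.
- apply (Csummable_bound _ b1); [exact S1|].
  intros n; apply B1; lra.
Qed.

(** * Summability of differences of consecutive terms *)

Lemma pow_le_exp (k : nat) (d : R) :
  0 < d -> exists A, 0 <= A /\ forall y, 0 <= y -> (1 + y) ^ k <= A * exp (d * y).
Proof.
revert d; induction k as [|k IH]; intros d Hd.
- exists 1; split; [lra|]; intros y Hy; simpl.
  assert (H := exp_ineq1_le (d * y)); assert (0 <= d * y) by (apply Rmult_le_pos; lra).
  lra.
- destruct (IH (d / 2)) as [A [HA H]]; [lra|].
  exists ((1 + 2 / d) * A); split.
    apply Rmult_le_pos; [|exact HA].
    assert (0 < 2 / d) by (apply Rdiv_lt_0_compat; lra); lra.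
  intros y Hy; replace (d * y) with (d / 2 * y + d / 2 * y) by field.
  rewrite exp_plus; simpl.
  replace ((1 + 2 / d) * A * (exp (d / 2 * y) * exp (d / 2 * y)))
    with (((1 + 2 / d) * exp (d / 2 * y)) * (A * exp (d / 2 * y))) by ring.
  assert (H1 := exp_ineq1_le (d / 2 * y)).
  assert (0 <= d / 2 * y) by (apply Rmult_le_pos; lra).
  apply Rmult_le_compat; [lra|apply pow_le; lra| |apply H, Hy].
  rewrite Rmult_plus_distr_r, Rmult_1_l; apply Rplus_le_compat; [lra|].
  replace y with (2 / d * (d / 2 * y)) at 1 by (field; lra).
  apply Rmult_le_compat_l; [apply Rlt_le, Rdiv_lt_0_compat|]; lra.
Qed.

Lemma exp_le (x y : R) : x <= y -> exp x <= exp y.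
Proof.
intros [H|H]; [apply Rlt_le, exp_increasing, H|rewrite H; apply Rle_refl].
Qed.

Lemma ln_nonneg (x : R) : 1 <= x -> 0 <= ln x.
Proof. intros H; rewrite <- ln_1; apply ln_le; lra. Qed.

(** Differentiating in [x] gains a factor [1/x]; half of the exponent [d] is
    then spent on absorbing the powers of [ln x]. *)
Lemma power_deriv_step (k : nat) (d M : R) :
  0 < d -> 0 <= M -> exists A, 0 <= A /\
    forall (s : C) (x : R), d <= Re s -> Cmod s <= M -> 1 <= x ->
      Cmod (power_deriv k (x + 1) s - power_deriv k x s) <= A * exp (- (1 + d / 2) * ln x).
Proof.
intros Hd HM; destruct (pow_le_exp k (d / 2)) as [A [HA H]]; [lra|].
assert (Hk := pos_INR k).
exists (2 * ((INR k + M) * A)); split.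
  apply Rmult_le_pos; [lra|]; apply Rmult_le_pos; lra.
intros s x Hs Ms Hx.
rewrite Rmult_assoc.
replace (2 * ((INR k + M) * A * exp (- (1 + d / 2) * ln x)))
  with (2 * ((INR k + M) * A * exp (- (1 + d / 2) * ln x)) * (x + 1 - x)) by ring.
apply (curve_mean_value_bound (fun x => power_deriv k x s)
  (fun x => - ((RtoC (INR k) * power_deriv (pred k) x s + s * power_deriv k x s) * RtoC (/ x)))%C).
  lra.
intros y Hy; split; [apply power_deriv_derive_base; lra|].
assert (L0 : 0 <= ln x) by (apply ln_nonneg; lra).
assert (L1 : ln x <= ln y) by (apply ln_le; lra).
rewrite Cmod_opp, Cmod_mult, Cmod_R, Rabs_right
  by (apply Rle_ge, Rlt_le, Rinv_0_lt_compat; lra).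
replace (/ y) with (exp (- ln y)) by (rewrite exp_Ropp, exp_ln; lra).
apply Rle_trans with (((INR k + M) * ((1 + ln y) ^ k * exp (- d * ln y))) * exp (- ln y)).
  apply Rmult_le_compat_r; [apply Rlt_le, exp_pos|].
  eapply Rle_trans; [apply Cmod_triangle|].
  rewrite 2!Cmod_mult, Cmod_R, Rabs_right, 2!Cmod_dterm by lra.
  rewrite Rmult_plus_distr_r.
  assert (X : exp (- Re s * ln y) <= exp (- d * ln y)).
    apply exp_le, Rmult_le_compat_r; lra.
  assert (P1 : ln y ^ k <= (1 + ln y) ^ k) by (apply pow_incr; lra).
  assert (P2 : ln y ^ pred k <= (1 + ln y) ^ k).
    apply Rle_trans with ((1 + ln y) ^ pred k); [apply pow_incr; lra|].
    apply Rle_pow; [lra|lia].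
  assert (E := exp_pos (- Re s * ln y)).
  apply Rplus_le_compat; apply Rmult_le_compat; try lra.
  - apply Rmult_le_pos; [apply pow_le|]; lra.
  - apply Rmult_le_compat; [apply pow_le; lra|lra|exact P2|exact X].
  - apply Cmod_ge_0.
  - apply Rmult_le_pos; [apply pow_le|]; lra.
  - apply Rmult_le_compat; [apply pow_le; lra|lra|exact P1|exact X].
apply Rle_trans with ((INR k + M) * ((A * exp (d / 2 * ln y)) * exp (- d * ln y)) * exp (- ln y)).
  apply Rmult_le_compat_r; [apply Rlt_le, exp_pos|].
  apply Rmult_le_compat_l; [lra|].
  apply Rmult_le_compat_r; [apply Rlt_le, exp_pos|].
  apply H; lra.
replace ((INR k + M) * (A * exp (d / 2 * ln y) * exp (- d * ln y)) * exp (- ln y))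
  with ((INR k + M) * A * (exp (d / 2 * ln y) * exp (- d * ln y) * exp (- ln y))) by ring.
rewrite <- 2!exp_plus.
apply Rmult_le_compat_l; [apply Rmult_le_pos; lra|].
replace (d / 2 * ln y + - d * ln y + - ln y) with (- ((1 + d / 2) * ln y)) by field.
replace (- (1 + d / 2) * ln x) with (- ((1 + d / 2) * ln x)) by ring.
assert (Q : (1 + d / 2) * ln x <= (1 + d / 2) * ln y) by (apply Rmult_le_compat_l; lra).
apply exp_le; lra.
Qed.

Lemma ln_succ_ge (x : R) : 0 < x -> / (x + 1) <= ln (x + 1) - ln x.
Proof.
intros Hx.
assert (E : ln x - ln (x + 1) = ln (x / (x + 1))) by (rewrite ln_div; lra).
assert (H := exp_ineq1_le (ln (x / (x + 1)))).
rewrite exp_ln in H by (apply Rdiv_lt_0_compat; lra).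
assert (x / (x + 1) = 1 - / (x + 1)) by (field; lra).
lra.
Qed.

(** The discrete form of [x^(-1-d) = - (x^(-d))' / d]: it yields the
    convergence of [sum n^(-1-d)] as well as the size of its tails. *)
Lemma negative_power_telescope (d x : R) :
  0 < d -> 0 < x ->
  exp (- (1 + d) * ln (x + 1)) <=
    / d * (exp (- d * ln x) - exp (- d * ln (x + 1))).
Proof.
intros Hd Hx; assert (H := ln_succ_ge x Hx).
apply (Rmult_le_reg_l d); [lra|].
rewrite <- Rmult_assoc, Rinv_r, Rmult_1_l by lra.
replace (- d * ln x) with (- d * ln (x + 1) + d * (ln (x + 1) - ln x)) by ring.
replace (- (1 + d) * ln (x + 1)) with (- d * ln (x + 1) + - ln (x + 1)) by ring.
rewrite 2!exp_plus, (exp_Ropp (ln (x + 1))), exp_ln by lra.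
assert (E := exp_pos (- d * ln (x + 1))).
replace (d * (exp (- d * ln (x + 1)) * / (x + 1)))
  with (exp (- d * ln (x + 1)) * (d * / (x + 1))) by ring.
match goal with |- _ <= ?a * ?b - ?a => replace (a * b - a) with (a * (b - 1)) by ring end.
apply Rmult_le_compat_l; [lra|].
assert (H1 := exp_ineq1_le (d * (ln (x + 1) - ln x))).
assert (d * / (x + 1) <= d * (ln (x + 1) - ln x)) by (apply Rmult_le_compat_l; lra).
lra.
Qed.

Lemma is_lim_seq_negative_power (d : R) :
  0 < d -> is_lim_seq (fun n => exp (- d * ln (INR (S n)))) 0.
Proof.
intros Hd.
apply (is_lim_comp_seq exp _ m_infty 0 is_lim_exp_m); [now exists 0%nat|].
replace m_infty with (Rbar_mult (- d) p_infty).
  apply is_lim_seq_scal_l.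
  apply (is_lim_comp_seq ln _ p_infty p_infty is_lim_ln_p); [now exists 0%nat|].
  apply (is_lim_seq_incr_1 INR), is_lim_seq_INR.
apply is_Rbar_mult_unique, is_Rbar_mult_sym, is_Rbar_mult_p_infty_neg; simpl; lra.
Qed.

Lemma sum_n_telescope (u : nat -> R) (n : nat) :
  sum_n (fun k => u k - u (S k)) n = u 0%nat - u (S n).
Proof.
induction n as [|n IH]; [now rewrite sum_O|].
rewrite sum_Sn, IH; unfold plus; simpl; ring.
Qed.

Lemma ex_series_negative_power (d : R) :
  0 < d -> ex_series (fun n => exp (- (1 + d) * ln (INR (S n)))).
Proof.
intros Hd; apply (ex_series_incr_1 (V := R_NormedModule)).
apply (ex_series_le (V := R_CompleteNormedModule) _ (fun n => / d * (exp (- d * ln (INR (S n)))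
  - exp (- d * ln (INR (S (S n))))))).
- intros n; unfold norm; simpl; unfold abs; simpl.
  rewrite Rabs_right by (apply Rle_ge, Rlt_le, exp_pos).
  assert (P := pos_INR n).
  assert (Q := negative_power_telescope d (INR (S n)) Hd).
  rewrite <- S_INR in Q; apply Q; rewrite S_INR; lra.
- apply (ex_series_scal (V := R_NormedModule)).
  exists (exp (- d * ln (INR 1))).
  assert (L : is_lim_seq (fun n => exp (- d * ln (INR 1))
    - exp (- d * ln (INR (S (S n))))) (exp (- d * ln (INR 1)) - 0)).
    apply is_lim_seq_minus'; [apply is_lim_seq_const|].
    apply (is_lim_seq_incr_1 (fun n => exp (- d * ln (INR (S n))))).
    apply is_lim_seq_negative_power, Hd.
  rewrite Rminus_0_r in L.
  eapply is_lim_seq_ext in L; [exact L|].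
  intros n; symmetry.
  apply (sum_n_telescope (fun n => exp (- d * ln (INR (S n))))).
Qed.

(** * Iterated complex differentiability on the critical strip *)

Definition strip (s : C) : Prop := 0 < Re s < 1.

Lemma strip_open (s : C) :
  strip s -> exists d, 0 < d /\ forall w, Cmod w < d -> strip (s + w)%C.
Proof.
intros [H0 H1]; exists (Rmin (Re s) (1 - Re s)); split.
  apply Rmin_glb_lt; lra.
intros w Hw; assert (H := Rabs_Re_le w).
assert (Cmod w < Re s) by (eapply Rlt_le_trans; [exact Hw|apply Rmin_l]).
assert (Cmod w < 1 - Re s) by (eapply Rlt_le_trans; [exact Hw|apply Rmin_r]).
assert (A := Rle_abs (Re w)); assert (B := Rle_abs (- Re w)); rewrite Rabs_Ropp in B.
unfold strip; replace (Re (s + w)) with (Re s + Re w) by reflexivity; lra.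
Qed.

Lemma cdiff_lipschitz (f : C -> C) (s l : C) :
  cdiff f s l -> exists d K, 0 < d /\ 0 <= K /\
    forall w, Cmod w < d -> Cmod (f (s + w) - f s)%C <= K * Cmod w.
Proof.
intros (d & M & Hd & HM & H); exists d, (M * d + Cmod l).
assert (Hl := Cmod_ge_0 l).
split; [exact Hd|split]; [assert (0 <= M * d) by (apply Rmult_le_pos; lra); lra|].
intros w Hw; assert (H1 := H w Hw); assert (Hw0 := Cmod_ge_0 w).
replace (f (s + w) - f s)%C with ((f (s + w) - f s - w * l) + w * l)%C by ring.
eapply Rle_trans; [apply Cmod_triangle|]; rewrite Cmod_mult.
assert (M * Cmod w ^ 2 <= M * d * Cmod w).
  replace (M * d * Cmod w) with (M * (d * Cmod w)) by ring.
  apply Rmult_le_compat_l; [lra|]; simpl; rewrite Rmult_1_r.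
  apply Rmult_le_compat_r; lra.
lra.
Qed.

Lemma cdiff_ext (f g : C -> C) (s l : C) :
  strip s -> (forall z, strip z -> f z = g z) -> cdiff f s l -> cdiff g s l.
Proof.
intros Hs E (d & M & Hd & HM & H).
destruct (strip_open s Hs) as [e [He O]].
exists (Rmin d e), M; split; [now apply Rmin_glb_lt|split; [exact HM|]].
intros w Hw; rewrite <- 2!E; [|exact Hs|].
- apply H; eapply Rlt_le_trans; [exact Hw|apply Rmin_l].
- apply O; eapply Rlt_le_trans; [exact Hw|apply Rmin_r].
Qed.

Lemma cdiff_mult (f g : C -> C) (s lf lg : C) :
  cdiff f s lf -> cdiff g s lg ->
  cdiff (fun z => f z * g z)%C s (lf * g s + f s * lg)%C.
Proof.
intros Df Dg.
destruct (cdiff_lipschitz _ _ _ Df) as (d1 & K1 & P1 & Q1 & L1).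
destruct (cdiff_lipschitz _ _ _ Dg) as (d2 & K2 & P2 & Q2 & L2).
destruct Df as (d3 & M3 & P3 & Q3 & H3), Dg as (d4 & M4 & P4 & Q4 & H4).
exists (Rmin (Rmin d1 d2) (Rmin d3 d4)),
  (Cmod (f s) * M4 + Cmod (g s) * M3 + K1 * K2).
assert (F := Cmod_ge_0 (f s)); assert (G := Cmod_ge_0 (g s)).
split; [repeat apply Rmin_glb_lt; assumption|split].
  repeat apply Rplus_le_le_0_compat; apply Rmult_le_pos; assumption.
intros w Hw.
assert (W := Cmod_ge_0 w).
assert (Rmin (Rmin d1 d2) (Rmin d3 d4) <= d1 /\ Rmin (Rmin d1 d2) (Rmin d3 d4) <= d2
  /\ Rmin (Rmin d1 d2) (Rmin d3 d4) <= d3 /\ Rmin (Rmin d1 d2) (Rmin d3 d4) <= d4)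
  as (E1 & E2 & E3 & E4).
  repeat split; unfold Rmin; repeat destruct Rle_dec; lra.
replace (f (s + w) * g (s + w) - f s * g s - w * (lf * g s + f s * lg))%C
  with (f s * (g (s + w) - g s - w * lg) + g s * (f (s + w) - f s - w * lf)
        + (f (s + w) - f s) * (g (s + w) - g s))%C by ring.
eapply Rle_trans; [apply Cmod_triangle|].
rewrite 2!Rmult_plus_distr_r; apply Rplus_le_compat.
- eapply Rle_trans; [apply Cmod_triangle|].
  rewrite 2!Cmod_mult, 2!Rmult_assoc.
  apply Rplus_le_compat; (apply Rmult_le_compat_l; [assumption|]).
  + apply H4; lra.
  + apply H3; lra.
- rewrite Cmod_mult.
  replace (K1 * K2 * Cmod w ^ 2) with ((K1 * Cmod w) * (K2 * Cmod w)) by ring.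
  apply Rmult_le_compat; try apply Cmod_ge_0; [apply L1|apply L2]; lra.
Qed.

Lemma cdiff_C_derive (f : C -> C) (s l : C) : cdiff f s l -> C_derive f s = l.
Proof.
intros (d & M & Hd & HM & H); apply is_C_derive_unique.
split; [apply is_linear_scal_l|].
intros x Hx.
assert (Ex : x = s).
  symmetry; apply (is_filter_lim_locally_unique (K := C_AbsRing)
    (V := AbsRing_NormedModule C_AbsRing)); exact Hx.
subst x; intros eps.
assert (Hp : 0 < Rmin d (eps / (M + 1))).
  apply Rmin_glb_lt; [exact Hd|].
  apply Rdiv_lt_0_compat; [apply cond_pos|lra].
assert (K : forall y : C, Cmod (y - s)%C < Rmin d (eps / (M + 1)) ->
  Cmod ((f y - f s) - (y - s) * l)%C <= eps * Cmod (y - s)%C).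
  intros y Hy; assert (H1 := H (y - s)%C).
  replace (s + (y - s))%C with y in H1 by ring.
  assert (A1 : Cmod (y - s)%C < d) by (eapply Rlt_le_trans; [exact Hy|apply Rmin_l]).
  assert (A2 : Cmod (y - s)%C < eps / (M + 1)) by (eapply Rlt_le_trans; [exact Hy|apply Rmin_r]).
  eapply Rle_trans; [apply H1, A1|].
  replace (M * Cmod (y - s)%C ^ 2) with (M * Cmod (y - s)%C * Cmod (y - s)%C) by ring.
  apply Rmult_le_compat_r; [apply Cmod_ge_0|].
  assert (B := Cmod_ge_0 (y - s)%C).
  apply Rle_trans with ((M + 1) * Cmod (y - s)%C).
    apply Rmult_le_compat_r; lra.
  apply Rle_trans with ((M + 1) * (eps / (M + 1))).
    apply Rmult_le_compat_l; lra.
  right; field; lra.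
exists (mkposreal _ Hp); intros y Hy; exact (K y Hy).
Qed.

(** [k] times differentiable on the strip.  No continuity is asked for at
    level 0: one further derivative supplies it. *)
Fixpoint smooth (k : nat) (f : C -> C) : Prop :=
  match k with
  | O => True
  | S j => exists g, (forall s, strip s -> cdiff f s (g s)) /\ smooth j g
  end.

Lemma smooth_pred (k : nat) (f : C -> C) : smooth (S k) f -> smooth k f.
Proof.
revert f; induction k as [|k IH]; intros f; [easy|].
intros [g [D S]]; exists g; split; [exact D|apply IH, S].
Qed.

Lemma smooth_ext (k : nat) (f g : C -> C) :
  (forall z, strip z -> f z = g z) -> smooth k f -> smooth k g.
Proof.
destruct k as [|k]; [easy|]; intros E [h [D S]]; exists h; split; [|exact S].
intros s Hs; apply (cdiff_ext f); auto.
Qed.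

Lemma cdiff_plus (f g : C -> C) (s lf lg : C) :
  cdiff f s lf -> cdiff g s lg -> cdiff (fun z => f z + g z)%C s (lf + lg)%C.
Proof.
intros (d3 & M3 & P3 & Q3 & H3) (d4 & M4 & P4 & Q4 & H4).
exists (Rmin d3 d4), (M3 + M4).
split; [apply Rmin_glb_lt; assumption|split; [lra|]].
intros w Hw.
replace (f (s + w) + g (s + w) - (f s + g s) - w * (lf + lg))%C
  with ((f (s + w) - f s - w * lf) + (g (s + w) - g s - w * lg))%C by ring.
eapply Rle_trans; [apply Cmod_triangle|]; rewrite Rmult_plus_distr_r.
apply Rplus_le_compat; [apply H3|apply H4];
  (eapply Rlt_le_trans; [exact Hw|]); [apply Rmin_l|apply Rmin_r].
Qed.

Lemma smooth_plus (k : nat) (f g : C -> C) :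
  smooth k f -> smooth k g -> smooth k (fun z => f z + g z)%C.
Proof.
revert f g; induction k as [|k IH]; intros f g; [easy|].
intros [f' [Df Sf]] [g' [Dg Sg]]; exists (fun z => f' z + g' z)%C; split.
- intros s Hs; apply cdiff_plus; auto.
- apply IH; assumption.
Qed.

Lemma smooth_mult (k : nat) (f g : C -> C) :
  smooth k f -> smooth k g -> smooth k (fun z => f z * g z)%C.
Proof.
revert f g; induction k as [|k IH]; intros f g; [easy|].
intros HF HG; assert (F := smooth_pred _ _ HF); assert (G := smooth_pred _ _ HG).
destruct HF as [f' [Df Sf]], HG as [g' [Dg Sg]].
exists (fun z => f' z * g z + f z * g' z)%C; split.
- intros s Hs; apply cdiff_mult; auto.
- apply smooth_plus; apply IH; assumption.
Qed.

Lemma smooth_chain (F : nat -> C -> C) :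
  (forall k s, strip s -> cdiff (F k) s (F (S k) s)) ->
  forall j k, smooth j (F k).
Proof.
intros H j; induction j as [|j IH]; intros k; [easy|].
exists (F (S k)); split; [apply H|apply IH].
Qed.

Lemma smooth_C_derive (k : nat) (f : C -> C) : smooth (S k) f -> smooth k (C_derive f).
Proof.
intros [g [D S]]; apply (smooth_ext k g); [|exact S].
intros z Hz; symmetry; apply cdiff_C_derive, D, Hz.
Qed.

Lemma smooth_iter_C_derive (r k : nat) (f : C -> C) :
  smooth (r + k) f -> smooth k (Nat.iter r C_derive f).
Proof.
revert k; induction r as [|r IH]; intros k H; [exact H|].
apply smooth_C_derive, IH.
now replace (r + S k)%nat with (S r + k)%nat by lia.
Qed.

(** * The alternating zeta function *)

(** [eta_term 0 n s] pairs the terms [2n+1] and [2n+2] of the alternating series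
    [sum (-1)^(m-1) m^(-s)], which makes it absolutely convergent for [Re s > 0];
    [k] counts derivatives in [s]. *)
Definition eta_term (k n : nat) (s : C) : C :=
  (power_deriv k (2 * INR n + 1) s - power_deriv k (2 * INR n + 1 + 1) s)%C.

Definition eta (k : nat) (s : C) : C := Csum (fun n => eta_term k n s).

Lemma eta_term_dominated (k : nat) (s : C) :
  strip s -> locally_dominated (eta_term k) s.
Proof.
intros [Hs _].
destruct (power_deriv_step k (Re s / 2) (Cmod s + Re s)) as [A [HA H]].
- lra.
- assert (H := Cmod_ge_0 s); lra.
- exists (Re s / 2),
    (fun n => A * exp (- (1 + Re s / 2 / 2) * ln (INR (S n)))).
  split; [lra|split].
    apply (ex_series_scal (V := R_NormedModule)).
    apply ex_series_negative_power; lra.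
  intros n z Hz; assert (P := pos_INR n).
  assert (Hr := Re_ge_sub_Cmod s z).
  unfold eta_term; rewrite <- Cmod_opp.
  match goal with |- context [Copp (?a - ?b)%C] =>
    replace (Copp (a - b)%C) with (b - a)%C by ring end.
  eapply Rle_trans; [apply H|].
  + lra.
  + replace z with ((z - s) + s)%C by ring.
    eapply Rle_trans; [apply Cmod_triangle|]; lra.
  + lra.
  + apply Rmult_le_compat_l; [exact HA|]; apply exp_le.
    rewrite S_INR.
    assert (ln (INR n + 1) <= ln (2 * INR n + 1)) by (apply ln_le; lra).
    assert (0 <= (1 + Re s / 2 / 2) * (ln (2 * INR n + 1) - ln (INR n + 1)))
      by (apply Rmult_le_pos; lra).
    lra.
Qed.

Lemma eta_term_derive (k n : nat) (s w : C) (u : R) :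
  curve_derive (fun u => eta_term k n (s + RtoC u * w)%C) u
    (w * eta_term (S k) n (s + RtoC u * w))%C.
Proof.
unfold eta_term.
destruct (power_deriv_derive_exponent k (2 * INR n + 1) s w u) as [A1 A2].
destruct (power_deriv_derive_exponent k (2 * INR n + 1 + 1) s w u) as [B1 B2].
unfold curve_derive in *.
match goal with |- context [Cmult w (?a - ?b)%C] =>
  replace (w * (a - b))%C with (w * a - w * b)%C by ring end.
split; [exact (is_derive_minus _ _ _ _ _ A1 B1)|exact (is_derive_minus _ _ _ _ _ A2 B2)].
Qed.

Lemma eta_cdiff (k : nat) (s : C) : strip s -> cdiff (eta k) s (eta (S k) s).
Proof.
intros Hs; apply (Csum_cdiff (eta_term k) (eta_term (S k)) (eta_term (S (S k))));
  try (apply eta_term_dominated, Hs); intros; apply eta_term_derive.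
Qed.

(** The [k]-th derivative of [2^(1-s)]. *)
Definition two_pow (k : nat) (s : C) : C := (RtoC 2 * power_deriv k 2 s)%C.

Lemma ln_2_bounds : 1 / 2 <= ln 2 <= 1.
Proof.
split; [apply Rlt_le; generalize ln_lt_2; lra|].
rewrite <- (ln_exp 1); apply ln_le; [lra|].
generalize (exp_ineq1_le 1); lra.
Qed.

Lemma power_deriv_2_cdiff (k : nat) (s : C) : cdiff (power_deriv k 2) s (power_deriv (S k) 2 s).
Proof.
assert (L2 := ln_2_bounds).
exists 1, (4 * exp (1 - Re s * ln 2)); split; [lra|split].
  assert (H := exp_pos (1 - Re s * ln 2)); lra.
intros w Hw.
apply (analytic_taylor_bound (power_deriv k 2) (power_deriv (S k) 2) (power_deriv (S (S k)) 2));
  try (intros; apply power_deriv_derive_exponent).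
intros z Hz; rewrite Cmod_dterm by lra.
apply Rle_trans with (1 * exp (1 - Re s * ln 2)); [|lra].
apply Rmult_le_compat; try (apply Rlt_le, exp_pos); [apply pow_le; lra| |].
  rewrite <- (pow1 (S (S k))); apply pow_incr; lra.
apply exp_le.
assert (Hr := Re_ge_sub_Cmod s z).
assert ((Re s - Re z) * ln 2 <= 1 * 1).
  destruct (Rle_dec 0 (Re s - Re z)); [apply Rmult_le_compat; lra|].
  assert (0 <= (Re z - Re s) * ln 2) by (apply Rmult_le_pos; lra); lra.
lra.
Qed.

Lemma two_pow_cdiff (k : nat) (s : C) : cdiff (two_pow k) s (two_pow (S k) s).
Proof.
destruct (power_deriv_2_cdiff k s) as (d & M & Hd & HM & H).
exists d, (2 * M); split; [lra|split; [lra|]]; intros w Hw.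
unfold two_pow.
replace (RtoC 2 * power_deriv k 2 (s + w) - RtoC 2 * power_deriv k 2 s
  - w * (RtoC 2 * power_deriv (S k) 2 s))%C
  with (RtoC 2 * (power_deriv k 2 (s + w) - power_deriv k 2 s - w * power_deriv (S k) 2 s))%C by ring.
rewrite Cmod_mult, Cmod_R, Rabs_right by lra.
rewrite Rmult_assoc; apply Rmult_le_compat_l; [lra|apply H, Hw].
Qed.

(** [|2^(1-s)| = 2^(1 - Re s)] exceeds 1 in the strip. *)
Lemma one_minus_two_pow_ge (s : C) :
  strip s -> (1 - Re s) / 2 <= Cmod (1 - two_pow 0 s)%C.
Proof.
intros [H0 H1]; assert (L2 := ln_2_bounds).
assert (E : Cmod (two_pow 0 s) = exp ((1 - Re s) * ln 2)).
  unfold two_pow; rewrite Cmod_mult, Cmod_R, Cmod_dterm, Rabs_right by lra; simpl.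
  replace ((1 - Re s) * ln 2) with (ln 2 + - Re s * ln 2) by ring.
  rewrite exp_plus, exp_ln by lra; ring.
assert (X := exp_ineq1_le ((1 - Re s) * ln 2)).
assert ((1 - Re s) * (1 / 2) <= (1 - Re s) * ln 2) by (apply Rmult_le_compat_l; lra).
assert (T := Cmod_triangle (- (1 - two_pow 0 s))%C 1%C).
replace (- (1 - two_pow 0 s) + 1)%C with (two_pow 0 s) in T by ring.
rewrite Cmod_opp, Cmod_1 in T; lra.
Qed.

Definition eta_factor_inv (s : C) : C := (/ (1 - two_pow 0 s))%C.

Lemma eta_factor_neq_0 (s : C) : strip s -> (1 - two_pow 0 s)%C <> 0%C.
Proof.
intros Hs E; assert (H := one_minus_two_pow_ge s Hs).
rewrite E, Cmod_0 in H; destruct Hs; lra.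
Qed.

Lemma eta_factor_inv_cdiff (s : C) :
  strip s ->
  cdiff eta_factor_inv s
    (eta_factor_inv s * eta_factor_inv s * two_pow 1 s)%C.
Proof.
intros Hs.
destruct (cdiff_lipschitz _ _ _ (two_pow_cdiff 0 s)) as (d1 & K1 & P1 & Q1 & L1).
destruct (two_pow_cdiff 0 s) as (d2 & M2 & P2 & Q2 & H2).
destruct (strip_open s Hs) as [d3 [P3 O]].
set (d4 := (1 - Re s) / 2); assert (P4 : 0 < d4) by (unfold d4; destruct Hs; lra).
set (I := Cmod (eta_factor_inv s)); assert (HI : 0 <= I) by apply Cmod_ge_0.
exists (Rmin (Rmin d1 d2) (Rmin d3 d4)),
  (I * I * M2 + 2 / d4 * (I * I) * (K1 * K1)).
assert (P5 : 0 < 2 / d4) by (apply Rdiv_lt_0_compat; lra).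
split; [repeat apply Rmin_glb_lt; assumption|split].
  apply Rplus_le_le_0_compat; repeat apply Rmult_le_pos; lra.
intros w Hw; assert (W := Cmod_ge_0 w).
assert (Rmin (Rmin d1 d2) (Rmin d3 d4) <= d1 /\ Rmin (Rmin d1 d2) (Rmin d3 d4) <= d2
  /\ Rmin (Rmin d1 d2) (Rmin d3 d4) <= d3 /\ Rmin (Rmin d1 d2) (Rmin d3 d4) <= d4)
  as (E1 & E2 & E3 & E4).
  repeat split; unfold Rmin; repeat destruct Rle_dec; lra.
assert (Hsw : strip (s + w)%C) by (apply O; lra).
assert (N0 := eta_factor_neq_0 s Hs); assert (N1 := eta_factor_neq_0 _ Hsw).
set (D := (two_pow 0 (s + w) - two_pow 0 s)%C).
replace (eta_factor_inv (s + w) - eta_factor_inv s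
   - w * (eta_factor_inv s * eta_factor_inv s * two_pow 1 s))%C
  with (eta_factor_inv s * eta_factor_inv s * (D - w * two_pow 1 s)
        + eta_factor_inv (s + w) * (eta_factor_inv s * eta_factor_inv s) * (D * D))%C
  by (unfold eta_factor_inv, D; field; auto).
eapply Rle_trans; [apply Cmod_triangle|].
rewrite !Cmod_mult; fold I.
rewrite Rmult_plus_distr_r; apply Rplus_le_compat.
- rewrite (Rmult_assoc (I * I) M2).
  apply Rmult_le_compat_l; [apply Rmult_le_pos; lra|].
  apply H2; lra.
- assert (HD : Cmod D <= K1 * Cmod w) by (apply L1; lra).
  assert (HD0 := Cmod_ge_0 D).
  replace (2 / d4 * (I * I) * (K1 * K1) * Cmod w ^ 2)
    with (2 / d4 * (I * I) * ((K1 * Cmod w) * (K1 * Cmod w))) by ring.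
  apply Rmult_le_compat.
  + repeat apply Rmult_le_pos; try lra; apply Cmod_ge_0.
  + apply Rmult_le_pos; lra.
  + apply Rmult_le_compat_r; [apply Rmult_le_pos; lra|].
    unfold eta_factor_inv; rewrite Cmod_inv by exact N1.
    replace (2 / d4) with (/ (d4 / 2)) by (field; lra).
    apply Rinv_le_contravar; [lra|].
    eapply Rle_trans; [|apply one_minus_two_pow_ge, Hsw].
    assert (A := Rle_abs (Re w)); assert (B := Rabs_Re_le w).
    replace (Re (s + w)) with (Re s + Re w) by reflexivity.
    unfold d4 in *; lra.
  + apply Rmult_le_compat; lra.
Qed.

(** Induction works because the derivative of [u = 1 / (1 - p)] is [u^2 p'],
    a product of functions already known to be one degree less smooth. *)
Lemma eta_factor_inv_smooth (k : nat) : smooth k eta_factor_inv.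
Proof.
induction k as [|k IH]; [easy|].
exists (fun s => eta_factor_inv s * eta_factor_inv s * two_pow 1 s)%C; split.
- apply eta_factor_inv_cdiff.
- apply smooth_mult; [now apply smooth_mult|].
  apply (smooth_chain two_pow); intros; apply two_pow_cdiff.
Qed.

Lemma curve_derive_reflect (f : R -> C) (a t : R) (l : C) :
  curve_derive f (a - t) l -> curve_derive (fun u => f (a - u)) t (- l)%C.
Proof.
intros [D1 D2]; split.
- replace (Re (- l)) with (scal (-1) (Re l))
    by (unfold scal; simpl; unfold mult; simpl; unfold Re; ring).
  apply (is_derive_comp (fun x => Re (f x)) (fun u => a - u)); [exact D1|].
  auto_derive; [easy|ring].
- replace (Im (- l)) with (scal (-1) (Im l))
    by (unfold scal; simpl; unfold mult; simpl; unfold Im; ring).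
  apply (is_derive_comp (fun x => Im (f x)) (fun u => a - u)); [exact D2|].
  auto_derive; [easy|ring].
Qed.

(** * Approximation of zeta by Dirichlet polynomials *)

Lemma power_deriv_0 (x : R) (s : C) : power_deriv 0 x s = Rcpow x (- s)%C.
Proof. unfold power_deriv; simpl; ring. Qed.

Lemma power_deriv_shift (x : R) (s : C) :
  0 < x -> power_deriv 0 x (s - 1)%C = (RtoC x * power_deriv 0 x s)%C.
Proof.
intros Hx; rewrite 2!power_deriv_polar; destruct s as [a b]; simpl; unfold Re, Im; simpl.
replace (- ((a + Ropp 1) * ln x)) with (ln x + - (a * ln x)) by ring.
rewrite exp_plus, exp_ln by exact Hx.
replace (b + Ropp 0) with b by ring.
unfold Cmult; simpl; f_equal; ring.
Qed.

Lemma power_deriv_mult (x y : R) (s : C) :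
  0 < x -> 0 < y -> (power_deriv 0 x s * power_deriv 0 y s)%C = power_deriv 0 (x * y) s.
Proof.
intros Hx Hy; rewrite 3!power_deriv_polar, ln_mult by assumption; simpl.
rewrite 2!Rmult_plus_distr_l, Ropp_plus_distr, exp_plus, cos_plus, sin_plus.
unfold Cmult; simpl; f_equal; ring.
Qed.

Definition zeta_partial (s : C) (N : nat) : C :=
  (sum_n (fun n => Rcpow (INR (S n)) (- s)) N
   - Rcpow (INR (S N)) (1 - s) / (1 - s))%C.

Lemma strip_one_minus_neq_0 (s : C) : strip s -> (1 - s)%C <> 0%C.
Proof.
intros [H0 H1] E; apply (f_equal Re) in E; destruct s as [a b];
  unfold Re in *; simpl in *; lra.
Qed.

(** With [h x = x^(1-s) / (1-s)], so that [h' x = x^(-s)], this is the Taylor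
    remainder of [h] at [x + 1], evaluated at [x]; [h''] has modulus
    [|s| x^(-1 - Re s)]. *)
Lemma euler_maclaurin_step (s : C) (x : R) :
  strip s -> 1 <= x ->
  Cmod (power_deriv 0 (x + 1) s
        - (power_deriv 0 (x + 1) (s - 1) / (1 - s) - power_deriv 0 x (s - 1) / (1 - s)))%C
    <= 4 * (Cmod s * exp (- (1 + Re s) * ln x)).
Proof.
intros Hs Hx; assert (N := strip_one_minus_neq_0 s Hs).
(* The Taylor bound expands at 0, so the curve runs backwards from [x + 1]. *)
set (f := fun u => (/ (1 - s) * power_deriv 0 (x + 1 - u) (s - 1))%C).
set (f1 := fun u => (- power_deriv 0 (x + 1 - u) s)%C).
replace (power_deriv 0 (x + 1) s
   - (power_deriv 0 (x + 1) (s - 1) / (1 - s) - power_deriv 0 x (s - 1) / (1 - s)))%C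
  with (f 1 - f 0 - f1 0)%C.
2:{ unfold f, f1; replace (x + 1 - 1) with x by ring.
    rewrite Rminus_0_r; field; exact N. }
apply (curve_taylor_bound f f1
  (fun u => - (RtoC (/ (x + 1 - u)) * (s * power_deriv 0 (x + 1 - u) s)))%C).
intros u Hu; split; [|split].
- unfold f1.
  replace (- power_deriv 0 (x + 1 - u) s)%C with
    (/ (1 - s) * - - ((RtoC (INR 0) * power_deriv (pred 0) (x + 1 - u) (s - 1)
       + (s - 1) * power_deriv 0 (x + 1 - u) (s - 1)) * RtoC (/ (x + 1 - u))))%C.
  2:{ change (INR 0) with 0; change (pred 0) with 0%nat.
      rewrite power_deriv_shift, RtoC_inv by lra.
      generalize (power_deriv 0 (x + 1 - u) s); intros D;
      field; split; [intros E; apply RtoC_inj in E; lra|exact N]. }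
  apply (curve_derive_scal (/ (1 - s))%C (fun u => power_deriv 0 (x + 1 - u) (s - 1)%C)).
  apply (curve_derive_reflect (fun y => power_deriv 0 y (s - 1)%C)).
  apply power_deriv_derive_base; lra.
- unfold f1.
  replace (- (RtoC (/ (x + 1 - u)) * (s * power_deriv 0 (x + 1 - u) s)))%C
    with (- RtoC 1 * - - ((RtoC (INR 0) * power_deriv (pred 0) (x + 1 - u) s
       + s * power_deriv 0 (x + 1 - u) s) * RtoC (/ (x + 1 - u))))%C
    by (simpl; ring).
  assert (K := curve_derive_scal (- RtoC 1)%C (fun u => power_deriv 0 (x + 1 - u) s) u
    (- - ((RtoC (INR 0) * power_deriv (pred 0) (x + 1 - u) s
       + s * power_deriv 0 (x + 1 - u) s) * RtoC (/ (x + 1 - u))))%C).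
  destruct K as [K1 K2].
    apply (curve_derive_reflect (fun y => power_deriv 0 y s)).
    apply power_deriv_derive_base; lra.
  split.
  + eapply is_derive_ext; [|exact K1]; intros t; simpl; unfold Re; simpl; ring.
  + eapply is_derive_ext; [|exact K2]; intros t; simpl; unfold Im; simpl; ring.
- rewrite Cmod_opp, 2!Cmod_mult, Cmod_R, Cmod_dterm by lra; simpl; rewrite Rmult_1_l.
  rewrite Rabs_right by (apply Rle_ge, Rlt_le, Rinv_0_lt_compat; lra).
  replace (/ (x + 1 - u)) with (exp (- ln (x + 1 - u)))
    by (rewrite exp_Ropp, exp_ln; lra).
  replace (exp (- ln (x + 1 - u)) * (Cmod s * exp (- Re s * ln (x + 1 - u))))
    with (Cmod s * (exp (- Re s * ln (x + 1 - u)) * exp (- ln (x + 1 - u)))) by ring.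
  apply Rmult_le_compat_l; [apply Cmod_ge_0|].
  rewrite <- exp_plus; apply exp_le.
  assert (ln x <= ln (x + 1 - u)) by (apply ln_le; lra).
  destruct Hs as [Hs _].
  assert (0 <= (1 + Re s) * (ln (x + 1 - u) - ln x)) by (apply Rmult_le_pos; lra).
  lra.
Qed.

(** An upper bound for the sum of all later increments of [zeta_partial s]. *)
Definition zeta_error (s : C) (N : nat) : R :=
  16 * Cmod s / Re s * exp (- Re s * ln (INR (S N))).

Lemma zeta_partial_step (s : C) (N : nat) :
  strip s ->
  Cmod (zeta_partial s (S N) - zeta_partial s N)%C
    <= zeta_error s N - zeta_error s (S N).
Proof.
intros Hs; assert (P := pos_INR N).
set (x := INR (S N)); assert (Hx : 1 <= x) by (unfold x; rewrite S_INR; lra).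
assert (E : (zeta_partial s (S N) - zeta_partial s N)%C
  = (power_deriv 0 (x + 1) s
     - (power_deriv 0 (x + 1) (s - 1) / (1 - s) - power_deriv 0 x (s - 1) / (1 - s)))%C).
  unfold zeta_partial; rewrite sum_Sn, 3!power_deriv_0, (S_INR (S N)); fold x.
  replace (- (s - 1))%C with (1 - s)%C by ring.
  change plus with Cplus; ring.
rewrite E; eapply Rle_trans; [apply euler_maclaurin_step; assumption|].
unfold zeta_error; rewrite (S_INR (S N)); fold x.
destruct Hs as [H0 H1].
assert (T := negative_power_telescope (Re s) x H0 ltac:(lra)).
assert (Q := Cmod_ge_0 s).
(* [negative_power_telescope] wants [x + 1] where the step has [x]. *)
assert (F : exp (- (1 + Re s) * ln x) <= 4 * exp (- (1 + Re s) * ln (x + 1))).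
  apply Rle_trans with (exp (ln 2 + ln 2) * exp (- (1 + Re s) * ln (x + 1))).
    rewrite <- exp_plus; apply exp_le.
    assert (L : ln (x + 1) <= ln 2 + ln x)
      by (rewrite <- ln_mult by lra; apply ln_le; lra).
    assert (L2 := ln_2_bounds).
    assert ((1 + Re s) * (ln (x + 1) - ln x) <= (1 + Re s) * ln 2)
      by (apply Rmult_le_compat_l; lra).
    assert (Re s * ln 2 <= 1 * ln 2) by (apply Rmult_le_compat_r; lra).
    lra.
  rewrite exp_plus, exp_ln by lra; lra.
replace (16 * Cmod s / Re s * exp (- Re s * ln x)
   - 16 * Cmod s / Re s * exp (- Re s * ln (x + 1)))
  with (16 * Cmod s * (/ Re s * (exp (- Re s * ln x) - exp (- Re s * ln (x + 1)))))
  by (field; lra).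
apply Rle_trans with (16 * Cmod s * exp (- (1 + Re s) * ln (x + 1))).
  replace (16 * Cmod s * exp (- (1 + Re s) * ln (x + 1)))
    with (4 * (Cmod s * (4 * exp (- (1 + Re s) * ln (x + 1))))) by ring.
  apply Rmult_le_compat_l; [lra|]; now apply Rmult_le_compat_l.
apply Rmult_le_compat_l; [lra|exact T].
Qed.

(** [u - b] increases, [u + b] decreases, and they are adjacent. *)
Lemma lim_seq_telescoping_bound (u b : nat -> R) :
  (forall n, Rabs (u (S n) - u n) <= b n - b (S n)) -> is_lim_seq b 0 ->
  exists l : R, is_lim_seq u l /\ forall n, Rabs (u n - l) <= b n.
Proof.
intros H Hb.
assert (V : forall n, u n - b n <= u (S n) - b (S n)).
  intros n; assert (K := H n); apply Rabs_le_between in K; lra.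
assert (W : forall n, u (S n) + b (S n) <= u n + b n).
  intros n; assert (K := H n); apply Rabs_le_between in K; lra.
destruct (ex_lim_seq_adj _ _ V W) as [[l Hl] _].
  apply (is_lim_seq_ext (fun n => 2 * b n)); [intros n; ring|].
  replace (Finite 0) with (Rbar_mult 2 0) by (simpl; f_equal; ring).
  now apply is_lim_seq_scal_l.
assert (U : is_lim_seq u l).
  apply (is_lim_seq_ext (fun n => (u n - b n) + b n)); [intros n; ring|].
  replace (Finite l) with (Finite (l + 0)) by (f_equal; ring).
  now apply is_lim_seq_plus'.
assert (U2 : is_lim_seq (fun n => u n + b n) l).
  replace (Finite l) with (Finite (l + 0)) by (f_equal; ring).
  now apply is_lim_seq_plus'.
exists l; split; [exact U|]; intros n.
assert (A := is_lim_seq_incr_compare _ _ Hl V n).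
assert (B := is_lim_seq_decr_compare _ _ U2 W n).
apply Rabs_le_between; lra.
Qed.

Lemma zeta_error_lim (s : C) : strip s -> is_lim_seq (zeta_error s) 0.
Proof.
intros [H0 _]; unfold zeta_error.
replace (Finite 0) with (Rbar_mult (16 * Cmod s / Re s) 0) by (simpl; f_equal; ring).
apply is_lim_seq_scal_l, is_lim_seq_negative_power, H0.
Qed.

Lemma zeta_partial_lim (s : C) :
  strip s ->
  is_lim_seq (fun N => Re (zeta_partial s N)) (Re (zeta s)) /\
  is_lim_seq (fun N => Im (zeta_partial s N)) (Im (zeta s)) /\
  forall N, Cmod (zeta s - zeta_partial s N)%C <= 2 * zeta_error s N.
Proof.
intros Hs.
destruct (lim_seq_telescoping_bound (fun N => Re (zeta_partial s N)) (zeta_error s))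
  as [a [La Ba]]; [|now apply zeta_error_lim|].
  intros N; eapply Rle_trans; [|apply zeta_partial_step, Hs].
  apply (Rabs_Re_le (zeta_partial s (S N) - zeta_partial s N)%C).
destruct (lim_seq_telescoping_bound (fun N => Im (zeta_partial s N)) (zeta_error s))
  as [b [Lb Bb]]; [|now apply zeta_error_lim|].
  intros N; eapply Rle_trans; [|apply zeta_partial_step, Hs].
  apply (Rabs_Im_le (zeta_partial s (S N) - zeta_partial s N)%C).
assert (E : zeta s = (a, b)).
  change (C_lim_seq (zeta_partial s) = (a, b)); unfold C_lim_seq.
  now rewrite (is_lim_seq_unique _ _ La), (is_lim_seq_unique _ _ Lb).
rewrite E; split; [exact La|split; [exact Lb|]].
intros N; rewrite <- Cmod_opp; eapply Rle_trans; [apply Cmod_le_Rabs|].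
assert (A1 := Ba N); assert (B1 := Bb N).
replace (Re (- ((a, b) - zeta_partial s N))) with (Re (zeta_partial s N) - a)
  by (simpl; unfold Re; ring).
replace (Im (- ((a, b) - zeta_partial s N))) with (Im (zeta_partial s N) - b)
  by (simpl; unfold Im; ring).
lra.
Qed.

(** Subtracting [2^(1-s)] times the sum over [n] doubles the even terms with a
    minus sign; the main terms [N^(1-s) / (1-s)] cancel exactly. *)
Lemma eta_partial (s : C) (N : nat) :
  strip s ->
  sum_n (fun n => eta_term 0 n s) N
  = (zeta_partial s (2 * N + 1) - two_pow 0 s * zeta_partial s N)%C :> C.
Proof.
intros Hs; assert (NZ := strip_one_minus_neq_0 s Hs).
assert (A : forall N, sum_n (fun n => eta_term 0 n s) N
  = (sum_n (fun n => Rcpow (INR (S n)) (- s)%C) (2 * N + 1)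
     - two_pow 0 s * sum_n (fun n => Rcpow (INR (S n)) (- s)%C) N)%C :> C).
  assert (T : forall n, (two_pow 0 s * Rcpow (INR (S n)) (- s))%C
     = (RtoC 2 * Rcpow (2 * INR n + 1 + 1) (- s))%C).
    intros n; unfold two_pow; assert (P := pos_INR n).
    rewrite <- 2!power_deriv_0, <- Cmult_assoc, power_deriv_mult by (try rewrite S_INR; lra).
    now replace (2 * INR (S n)) with (2 * INR n + 1 + 1) by (rewrite S_INR; ring).
  intros n; induction n as [|n IH].
  - change (2 * 0 + 1)%nat with 1%nat; rewrite sum_Sn, !sum_O, (T 0%nat).
    unfold eta_term; rewrite 2!power_deriv_0; change plus with Cplus.
    change (INR 0) with 0; change (INR 1) with 1; change (INR 2) with (1 + 1).
    replace (2 * 0 + 1) with 1 by ring. ring.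
  - replace (2 * S n + 1)%nat with (S (S (2 * n + 1))) by lia.
    rewrite !sum_Sn, IH; change plus with Cplus.
    rewrite (Cmult_plus_distr_l (two_pow 0 s)), (T (S n)).
    unfold eta_term; rewrite 2!power_deriv_0.
    replace (2 * INR (S n) + 1) with (INR (S (S (2 * n + 1))))
      by (rewrite !S_INR, plus_INR, mult_INR; simpl; ring).
    rewrite <- S_INR. ring.
rewrite A; unfold zeta_partial.
replace (Rcpow (INR (S (2 * N + 1))) (1 - s))%C
  with (two_pow 0 s * Rcpow (INR (S N)) (1 - s))%C.
  field; exact NZ.
assert (P := pos_INR N).
replace (1 - s)%C with (- (s - 1))%C by ring.
unfold two_pow; rewrite <- 2!power_deriv_0, 2!power_deriv_shift
  by (rewrite S_INR; apply Rle_lt_0_plus_1, pos_INR).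
replace (INR (S (2 * N + 1))) with (2 * INR (S N))
  by (rewrite !S_INR, plus_INR, mult_INR; simpl; ring).
rewrite <- power_deriv_mult by (try rewrite S_INR; lra).
rewrite RtoC_mult; ring.
Qed.

Lemma sum_n_Re (u : nat -> C) (N : nat) :
  Re (sum_n u N) = sum_n (fun n => Re (u n)) N.
Proof.
induction N as [|N IH]; [now rewrite !sum_O|].
rewrite !sum_Sn, <- IH; reflexivity.
Qed.

Lemma sum_n_Im (u : nat -> C) (N : nat) :
  Im (sum_n u N) = sum_n (fun n => Im (u n)) N.
Proof.
induction N as [|N IH]; [now rewrite !sum_O|].
rewrite !sum_Sn, <- IH; reflexivity.
Qed.

Lemma zeta_eta (s : C) :
  strip s -> (eta 0 s * eta_factor_inv s)%C = zeta s.
Proof.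
intros Hs; destruct (zeta_partial_lim s Hs) as [LR [LI _]].
assert (L2 : forall u (l : Rbar), is_lim_seq u l -> is_lim_seq (fun N => u (2 * N + 1)%nat) l).
  intros u l; apply is_lim_seq_subseq.
  apply eventually_subseq; intros n; lia.
assert (E : eta 0 s = (zeta s * (1 - two_pow 0 s))%C).
  unfold eta, Csum; apply injective_projections.
  - apply is_series_unique.
    change (is_lim_seq (sum_n (fun n => Re (eta_term 0 n s)))
             (Re (zeta s * (1 - two_pow 0 s)))).
    apply (is_lim_seq_ext (fun N => Re (zeta_partial s (2 * N + 1))
      - (Re (two_pow 0 s) * Re (zeta_partial s N)
         - Im (two_pow 0 s) * Im (zeta_partial s N)))).
      intros N; rewrite <- sum_n_Re, eta_partial by exact Hs; reflexivity.
    replace (Re (zeta s * (1 - two_pow 0 s))) with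
      (Re (zeta s) - (Re (two_pow 0 s) * Re (zeta s) - Im (two_pow 0 s) * Im (zeta s)))
      by (simpl; unfold Re, Im; ring).
    apply is_lim_seq_minus'; [apply (L2 _ _ LR)|].
    apply is_lim_seq_minus'; [apply (is_lim_seq_scal_l _ _ _ LR)
      |apply (is_lim_seq_scal_l _ _ _ LI)].
  - apply is_series_unique.
    change (is_lim_seq (sum_n (fun n => Im (eta_term 0 n s)))
             (Im (zeta s * (1 - two_pow 0 s)))).
    apply (is_lim_seq_ext (fun N => Im (zeta_partial s (2 * N + 1))
      - (Re (two_pow 0 s) * Im (zeta_partial s N)
         + Im (two_pow 0 s) * Re (zeta_partial s N)))).
      intros N; rewrite <- sum_n_Im, eta_partial by exact Hs; reflexivity.
    replace (Im (zeta s * (1 - two_pow 0 s))) with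
      (Im (zeta s) - (Re (two_pow 0 s) * Im (zeta s) + Im (two_pow 0 s) * Re (zeta s)))
      by (simpl; unfold Re, Im; ring).
    apply is_lim_seq_minus'; [apply (L2 _ _ LI)|].
    apply is_lim_seq_plus'; [apply (is_lim_seq_scal_l _ _ _ LI)
      |apply (is_lim_seq_scal_l _ _ _ LR)].
rewrite E; unfold eta_factor_inv; field; apply eta_factor_neq_0, Hs.
Qed.

Lemma zeta_smooth (k : nat) : smooth k zeta.
Proof.
apply (smooth_ext k (fun s => eta 0 s * eta_factor_inv s)%C).
  exact zeta_eta.
apply smooth_mult; [|apply eta_factor_inv_smooth].
apply (smooth_chain eta); apply eta_cdiff.
Qed.

Lemma critical_strip (t : R) : strip (critical_point t).
Proof. unfold strip, critical_point; simpl; lra. Qed.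

Lemma zeta_deriv_continuous (r : nat) (t : R) :
  continuous (fun t => Cmod (zeta_deriv r (critical_point t))) t.
Proof.
destruct (smooth_iter_C_derive r 1 zeta (zeta_smooth _)) as [g [D _]].
destruct (cdiff_lipschitz _ _ _ (D _ (critical_strip t))) as (d & K & Hd & HK & L).
fold (zeta_deriv r) in L.
apply continuity_pt_filterlim; intros e He.
exists (Rmin d (e / (K + 1))); split.
  apply Rmin_glb_lt; [exact Hd|apply Rdiv_lt_0_compat; lra].
intros x [_ Hx]; unfold dist in *; simpl in *; unfold R_dist in *.
assert (A1 : Rabs (x - t) < d) by (eapply Rlt_le_trans; [exact Hx|apply Rmin_l]).
assert (A2 : Rabs (x - t) < e / (K + 1)) by (eapply Rlt_le_trans; [exact Hx|apply Rmin_r]).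
assert (W : Cmod (0, x - t) = Rabs (x - t)).
  assert (E : (0, x - t) = (Ci * RtoC (x - t))%C)
    by (unfold Cmult, RtoC, Ci; simpl; f_equal; ring).
  rewrite E, Cmod_mult, Cmod_R, Cmod_Ci; ring.
assert (B := L (0, x - t)); rewrite W in B.
replace (critical_point t + (0, (x - t)%R))%C with (critical_point x) in B
  by (unfold critical_point, Cplus; simpl; f_equal; ring).
specialize (B A1).
apply Rle_lt_trans with (K * Rabs (x - t)).
- eapply Rle_trans; [|exact B].
  apply Rabs_le_between.
  set (p := zeta_deriv r (critical_point x)); set (q := zeta_deriv r (critical_point t)).
  assert (T1 := Cmod_triangle (p - q) q); assert (T2 := Cmod_triangle (- (p - q)) p).
  replace (p - q + q)%C with p in T1 by ring.
  replace (- (p - q) + p)%C with q in T2 by ring.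
  rewrite Cmod_opp in T2; lra.
- assert (P := Rabs_pos (x - t)).
  apply Rle_lt_trans with ((K + 1) * Rabs (x - t)); [apply Rmult_le_compat_r; lra|].
  replace e with ((K + 1) * (e / (K + 1))) by (field; lra).
  apply Rmult_lt_compat_l; lra.
Qed.

(** * Mean square of a Dirichlet polynomial *)

Definition freq (n : nat) : R := ln (INR (S n)).
Definition amp (n : nat) : R := / sqrt (INR (S n)).

(** [|sum_(n <= N+1) n^(-1/2-it)|^2], see [Cmod_dirichlet_poly_sq]. *)
Definition dirichlet_poly_sq (N : nat) (t : R) : R :=
  sum_n (fun n => amp n * cos (t * freq n)) N ^ 2
  + sum_n (fun n => amp n * sin (t * freq n)) N ^ 2.

Lemma INR_S_pos (n : nat) : 0 < INR (S n).
Proof. apply lt_0_INR; lia. Qed.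

Lemma amp_pos (n : nat) : 0 < amp n.
Proof. apply Rinv_0_lt_compat, sqrt_lt_R0, INR_S_pos. Qed.

Lemma inv_sqrt_le (x : R) : 1 <= x -> / sqrt x <= 2 * (sqrt x - sqrt (x - 1)).
Proof.
intros Hx; assert (P : 0 < sqrt x) by (apply sqrt_lt_R0; lra).
assert (Q := sqrt_pos (x - 1)).
assert (E1 := sqrt_sqrt x ltac:(lra)); assert (E2 := sqrt_sqrt (x - 1) ltac:(lra)).
apply (Rmult_le_reg_l (sqrt x)); [exact P|]; rewrite Rinv_r by lra.
assert (0 <= (sqrt x - sqrt (x - 1)) * (sqrt x - sqrt (x - 1))) by apply Rle_0_sqr.
nra.
Qed.

Lemma sum_inv_sqrt_reversed (N m : nat) :
  (m <= N)%nat ->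
  sum_n (fun k => / sqrt (INR (S N - k))) m
    <= 2 * (sqrt (INR (S N)) - sqrt (INR (N - m))).
Proof.
induction m as [|m IH]; intros Hm.
- rewrite sum_O, 2!Nat.sub_0_r.
  replace (INR N) with (INR (S N) - 1) by (rewrite S_INR; ring).
  apply inv_sqrt_le; rewrite S_INR; generalize (pos_INR N); lra.
- rewrite sum_Sn; change plus with Rplus.
  assert (IH' := IH ltac:(lia)).
  replace (S N - S m)%nat with (N - m)%nat by lia.
  replace (INR (N - S m)) with (INR (N - m) - 1).
  2:{ replace (N - m)%nat with (S (N - S m)) by lia; rewrite S_INR; ring. }
  assert (1 <= INR (N - m)) by (apply (le_INR 1); lia).
  assert (K := inv_sqrt_le (INR (N - m)) ltac:(assumption)); lra.
Qed.

Lemma freq_gap (k n : nat) :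
  (k < n)%nat -> INR (n - k) / INR (S n) <= freq n - freq k.
Proof.
intros H; unfold freq; assert (A := INR_S_pos n); assert (B := INR_S_pos k).
assert (E : ln (INR (S k)) - ln (INR (S n)) = ln (INR (S k) / INR (S n)))
  by (rewrite ln_div; lra).
assert (X := exp_ineq1_le (ln (INR (S k) / INR (S n)))).
rewrite exp_ln in X by (apply Rdiv_lt_0_compat; lra).
replace (INR (n - k) / INR (S n)) with (1 - INR (S k) / INR (S n)).
  lra.
rewrite minus_INR, 2!S_INR by lia; field; rewrite S_INR in A; lra.
Qed.

(** With [i = k + 1], [n = N + 2], [j = n - i], the gap of the frequencies is at
    least [j / n], so the quotient is at most [sqrt n / (sqrt i * j)]; and
    [i j >= n - 1 >= n / 2] absorbs [sqrt n]. *)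
Lemma amp_quotient_bound (N k : nat) :
  (k <= N)%nat ->
  0 < freq (S N) - freq k /\
  amp k * amp (S N) / (freq (S N) - freq k) <= 3 / 2 * / sqrt (INR (S N - k)).
Proof.
intros Hk; assert (G := freq_gap k (S N) ltac:(lia)).
assert (A := INR_S_pos (S N)); assert (B := INR_S_pos k).
assert (J : 1 <= INR (S N - k)) by (apply (le_INR 1); lia).
assert (D : 0 < INR (S N - k) / INR (S (S N))) by (apply Rdiv_lt_0_compat; lra).
split; [lra|].
assert (PI : 1 <= INR (S k)) by (apply (le_INR 1); lia).
assert (SUM : INR (S (S N)) = INR (S k) + INR (S N - k)).
  rewrite <- plus_INR; f_equal; lia.
set (n := INR (S (S N))) in *; set (j := INR (S N - k)) in *.
unfold amp; fold n; set (i := INR (S k)) in *.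
assert (Sn : 0 < sqrt n) by (apply sqrt_lt_R0; lra).
assert (Si : 0 < sqrt i) by (apply sqrt_lt_R0; lra).
assert (Sj : 0 < sqrt j) by (apply sqrt_lt_R0; lra).
assert (K : sqrt n <= 3 / 2 * (sqrt i * sqrt j)).
  rewrite <- sqrt_mult by lra.
  replace (3 / 2) with (sqrt (3 / 2 * (3 / 2))) by (apply sqrt_square; lra).
  rewrite <- sqrt_mult by nra; apply sqrt_le_1_alt; nra.
apply Rle_trans with (/ sqrt i * / sqrt n * (n / j)).
  unfold Rdiv at 1; apply Rmult_le_compat_l.
    apply Rmult_le_pos; apply Rlt_le, Rinv_0_lt_compat; assumption.
  replace (n / j) with (/ (j / n)) by (field; lra).
  apply Rinv_le_contravar; assumption.
replace (/ sqrt i * / sqrt n * (n / j)) with (sqrt n / (sqrt i * (sqrt j * sqrt j))).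
2:{ rewrite (sqrt_sqrt j) by lra.
    replace n with (sqrt n * sqrt n) at 3 by (apply sqrt_sqrt; lra).
    field; lra. }
replace (3 / 2 * / sqrt j)
  with ((3 / 2 * (sqrt i * sqrt j)) / (sqrt i * (sqrt j * sqrt j))) by (field; lra).
apply Rmult_le_compat_r; [|exact K].
apply Rlt_le, Rinv_0_lt_compat; repeat apply Rmult_lt_0_compat; assumption.
Qed.

Lemma cross_sum (N n : nat) (t : R) :
  sum_n (fun k => amp k * cos (t * freq k)) N * (amp n * cos (t * freq n))
  + sum_n (fun k => amp k * sin (t * freq k)) N * (amp n * sin (t * freq n))
  = sum_n (fun k => amp k * amp n * cos (t * (freq n - freq k))) N.
Proof.
assert (C : forall k, cos (t * (freq n - freq k))
  = cos (t * freq n) * cos (t * freq k) + sin (t * freq n) * sin (t * freq k)).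
  intros k; rewrite Rmult_minus_distr_l; apply cos_minus.
induction N as [|N IH].
- rewrite 3!sum_O, C; ring.
- rewrite 3!sum_Sn, C, <- IH; change plus with Rplus; ring.
Qed.

Lemma dirichlet_poly_sq_step (N : nat) (t : R) :
  dirichlet_poly_sq (S N) t
  = dirichlet_poly_sq N t
    + 2 * sum_n (fun k => amp k * amp (S N) * cos (t * (freq (S N) - freq k))) N
    + amp (S N) ^ 2.
Proof.
rewrite <- cross_sum; unfold dirichlet_poly_sq; rewrite 2!sum_Sn; change plus with Rplus.
assert (T := sin2_cos2 (t * freq (S N))); unfold Rsqr in T.
replace (amp (S N) ^ 2) with (amp (S N) ^ 2 *
  (sin (t * freq (S N)) * sin (t * freq (S N)) + cos (t * freq (S N)) * cos (t * freq (S N))))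
  by (rewrite T; ring).
ring.
Qed.

Definition cross_primitive (N : nat) (t : R) : R :=
  sum_n (fun k => amp k * amp (S N) / (freq (S N) - freq k)
                  * sin (t * (freq (S N) - freq k))) N.

Lemma is_derive_cross_primitive (N : nat) (t : R) :
  is_derive (cross_primitive N) t
    (sum_n (fun k => amp k * amp (S N) * cos (t * (freq (S N) - freq k))) N).
Proof.
apply (is_derive_sum_n (fun k t => amp k * amp (S N) / (freq (S N) - freq k)
                  * sin (t * (freq (S N) - freq k)))).
intros k Hk; destruct (amp_quotient_bound N k Hk) as [G _].
auto_derive; [easy|field; lra].
Qed.

Lemma sum_n_le_loc (u v : nat -> R) (N : nat) :
  (forall k, (k <= N)%nat -> u k <= v k) -> sum_n u N <= sum_n v N.
Proof.
induction N as [|N IH]; intros H; [rewrite 2!sum_O; apply H; lia|].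
rewrite 2!sum_Sn; apply Rplus_le_compat; [apply IH; intros; apply H; lia|apply H; lia].
Qed.

Lemma cross_primitive_bound (N : nat) (t : R) :
  Rabs (cross_primitive N t) <= 3 * sqrt (INR (S N)).
Proof.
apply Rle_trans with (sum_n (fun k => 3 / 2 * / sqrt (INR (S N - k))) N).
- eapply Rle_trans; [apply (norm_sum_n_m (V := R_NormedModule))|].
  apply sum_n_le_loc; intros k Hk; destruct (amp_quotient_bound N k Hk) as [G B].
  eapply Rle_trans; [|exact B].
  unfold norm; simpl; unfold abs; simpl; rewrite Rabs_mult.
  assert (P : 0 <= amp k * amp (S N) / (freq (S N) - freq k)).
    apply Rlt_le, Rdiv_lt_0_compat; [|exact G].
    apply Rmult_lt_0_compat; apply amp_pos.
  rewrite Rabs_right by lra.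
  rewrite <- (Rmult_1_r (_ / _)) at 2; apply Rmult_le_compat_l; [exact P|].
  apply Rabs_le; apply SIN_bound.
- rewrite (sum_n_mult_l (K := R_Ring) (3 / 2)); change mult with Rmult.
  assert (T := sum_inv_sqrt_reversed N N (le_n N)).
  rewrite Nat.sub_diag in T; change (INR 0) with 0 in T; rewrite sqrt_0 in T.
  eapply Rle_trans; [apply Rmult_le_compat_l; [lra|exact T]|lra].
Qed.

(** The diagonal terms integrate to [(b - a) sum 1/n], the off-diagonal ones
    have bounded oscillating primitives.  Both estimates are crude
    ([sum 1/n <= 2 sqrt N] instead of a logarithm), but still leave a power to
    spare. *)
Lemma dirichlet_poly_sq_primitive (N : nat) :
  exists P : R -> R,
    (forall t, is_derive P t (dirichlet_poly_sq N t)) /\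
    forall a b, a <= b ->
      P b - P a <= 2 * sqrt (INR (S N)) * (b - a) + 12 * (INR (S N) * sqrt (INR (S N))).
Proof.
induction N as [|N [P [D B]]].
- exists (fun t => t); split.
  + intros t; unfold dirichlet_poly_sq; rewrite 2!sum_O; unfold amp, freq; simpl.
    rewrite sqrt_1, ln_1, Rmult_0_r, cos_0, sin_0.
    auto_derive; [easy|field].
  + intros a b Hab; simpl; rewrite sqrt_1; lra.
- exists (fun t => P t + 2 * cross_primitive N t + amp (S N) ^ 2 * t); split.
  + intros t; rewrite dirichlet_poly_sq_step.
    apply (is_derive_plus (fun t => P t + 2 * cross_primitive N t) (fun t => amp (S N) ^ 2 * t)).
    * apply (is_derive_plus P (fun t => 2 * cross_primitive N t)); [apply D|].
      apply (is_derive_scal (cross_primitive N)), is_derive_cross_primitive.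
    * auto_derive; [easy|ring].
  + intros a b Hab; assert (B' := B a b Hab).
    assert (Ca := cross_primitive_bound N a); assert (Cb := cross_primitive_bound N b).
    apply Rabs_le_between in Ca; apply Rabs_le_between in Cb.
    assert (Q := INR_S_pos N).
    assert (A2 : amp (S N) ^ 2 <= 2 * (sqrt (INR (S (S N))) - sqrt (INR (S N)))).
      assert (K := inv_sqrt_le (INR (S (S N))) ltac:(rewrite S_INR; lra)).
      replace (INR (S (S N)) - 1) with (INR (S N)) in K by (rewrite (S_INR (S N)); ring).
      eapply Rle_trans; [|exact K].
      assert (X := amp_pos (S N)); unfold amp in *.
      assert (Y : / sqrt (INR (S (S N))) <= / 1).
        apply Rinv_le_contravar; [lra|].
        rewrite <- sqrt_1; apply sqrt_le_1_alt; rewrite (S_INR (S N)); lra.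
      rewrite Rinv_1 in Y; nra.
    assert (A3 := Rmult_le_compat_r (b - a) _ _ ltac:(lra) A2).
    assert (M : sqrt (INR (S N)) <= sqrt (INR (S (S N))))
      by (apply sqrt_le_1_alt; rewrite (S_INR (S N)); lra).
    assert (M2 : INR (S (S N)) * sqrt (INR (S N)) <= INR (S (S N)) * sqrt (INR (S (S N)))).
      apply Rmult_le_compat_l; [apply pos_INR|exact M].
    assert (E : INR (S (S N)) * sqrt (INR (S N)) = INR (S N) * sqrt (INR (S N)) + sqrt (INR (S N)))
      by (rewrite (S_INR (S N)); ring).
    lra.
Qed.

Lemma exp_neg_half_ln (x : R) : 0 < x -> exp (- (1 / 2 * ln x)) = / sqrt x.
Proof.
intros Hx; rewrite exp_Ropp; f_equal; rewrite <- Rpower_sqrt by exact Hx.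
unfold Rpower; f_equal; lra.
Qed.

Lemma Cmod_dirichlet_poly_sq (N : nat) (t : R) :
  Cmod (sum_n (fun n => Rcpow (INR (S n)) (- critical_point t)%C) N) ^ 2
  = dirichlet_poly_sq N t.
Proof.
unfold Cmod; rewrite pow2_sqrt by (apply Rplus_le_le_0_compat; apply pow2_ge_0).
change (Re (sum_n (fun n => Rcpow (INR (S n)) (- critical_point t)%C) N) ^ 2
  + Im (sum_n (fun n => Rcpow (INR (S n)) (- critical_point t)%C) N) ^ 2 = dirichlet_poly_sq N t).
rewrite sum_n_Re, sum_n_Im; unfold dirichlet_poly_sq; f_equal.
- f_equal; apply sum_n_ext; intros n; rewrite <- power_deriv_0, power_deriv_polar.
  unfold critical_point, Re, Im; cbn [fst snd pow].
  rewrite exp_neg_half_ln by apply INR_S_pos; unfold amp, freq.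
  match goal with |- @eq _ ?a ?b => change (@eq R a b) end; ring.
- rewrite <- (Rmult_1_l (_ ^ 2)); replace 1 with ((-1) ^ 2) by ring.
  rewrite <- Rpow_mult_distr; f_equal.
  rewrite <- (sum_n_mult_l (K := R_Ring) (-1)).
  apply sum_n_ext; intros n; rewrite <- power_deriv_0, power_deriv_polar.
  unfold critical_point, Re, Im; cbn [fst snd pow].
  rewrite exp_neg_half_ln by apply INR_S_pos; change mult with Rmult; unfold amp, freq.
  match goal with |- @eq _ ?a ?b => change (@eq R a b) end; ring.
Qed.

(** * Growth of functions whose derivative is at most |zeta|^2 *)

(** The three contributions are the Dirichlet polynomial, the main term
    [N^(1-s) / (1-s)] and the Euler-Maclaurin error. *)
Lemma zeta_critical_bound (N : nat) (t : R) :
  1 <= t ->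
  Cmod (zeta (critical_point t)) ^ 2
  <= 3 * (dirichlet_poly_sq N t + INR (S N) / t ^ 2 + 16384 * t ^ 2 / INR (S N)).
Proof.
intros Ht; set (s := critical_point t); assert (Hs := critical_strip t); fold s in Hs.
destruct (zeta_partial_lim s Hs) as [_ [_ E]]; specialize (E N).
set (m := INR (S N)) in *; assert (Hm : 0 < m) by apply INR_S_pos.
assert (Sm : 0 < sqrt m) by now apply sqrt_lt_R0.
set (D := sum_n (fun n => Rcpow (INR (S n)) (- s)%C) N).
set (H := (Rcpow m (1 - s) / (1 - s))%C).
assert (Z : zeta s = (D + - H + (zeta s - zeta_partial s N))%C).
  unfold zeta_partial; fold m; fold D; fold H; ring.
assert (B1 : Cmod H <= sqrt m / t).
  unfold H; rewrite Cmod_div by now apply strip_one_minus_neq_0.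
  unfold Rcpow; rewrite Cmod_Cexp.
  replace (Re ((1 - s) * RtoC (ln m))) with (- - (1 / 2 * ln m))
    by (unfold s, critical_point, Re; simpl; field).
  rewrite exp_Ropp, exp_neg_half_ln, Rinv_inv by exact Hm.
  apply Rmult_le_compat_l; [lra|]; apply Rinv_le_contravar; [lra|].
  eapply Rle_trans; [|apply Rabs_Im_le].
  replace (Im (1 - s)) with (- t) by (unfold s, critical_point, Im; simpl; ring).
  rewrite Rabs_Ropp; apply Rle_abs.
assert (B2 : Cmod (zeta s - zeta_partial s N)%C <= 128 * t / sqrt m).
  eapply Rle_trans; [exact E|].
  assert (Cs : Cmod s <= 2 * t).
    eapply Rle_trans; [apply Cmod_le_Rabs|]; unfold s, critical_point, Re, Im; simpl.
    rewrite 2!Rabs_right by lra; lra.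
  unfold zeta_error; fold m.
  replace (- Re s * ln m) with (- (1 / 2 * ln m))
    by (unfold s, critical_point, Re; simpl; field).
  rewrite exp_neg_half_ln by exact Hm.
  replace (Re s) with (1 / 2) by reflexivity.
  replace (2 * (16 * Cmod s / (1 / 2) * / sqrt m)) with (64 * Cmod s / sqrt m) by (field; lra).
  apply Rmult_le_compat_r; [apply Rlt_le, Rinv_0_lt_compat, Sm|lra].
assert (T : Cmod (zeta s) <= Cmod D + sqrt m / t + 128 * t / sqrt m).
  rewrite Z; eapply Rle_trans; [apply Cmod_triangle|].
  apply Rplus_le_compat; [|exact B2].
  eapply Rle_trans; [apply Cmod_triangle|]; rewrite Cmod_opp; lra.
rewrite <- Cmod_dirichlet_poly_sq; fold s; fold D.
replace (m / t ^ 2) with ((sqrt m / t) ^ 2).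
2:{ rewrite <- (sqrt_sqrt m) at 2 by lra; field; lra. }
replace (16384 * t ^ 2 / m) with ((128 * t / sqrt m) ^ 2).
2:{ rewrite <- (sqrt_sqrt m) at 2 by lra; field; lra. }
assert (P := Cmod_ge_0 (zeta s)).
set (x := Cmod D) in *; set (y := sqrt m / t) in *; set (z := 128 * t / sqrt m) in *.
apply Rle_trans with ((x + y + z) ^ 2); [apply pow_incr; lra|].
assert (K1 := pow2_ge_0 (x - y)); assert (K2 := pow2_ge_0 (y - z));
assert (K3 := pow2_ge_0 (x - z)).
nra.
Qed.

(** The pointwise bound of [zeta_critical_bound] has an explicit primitive, so
    the growth of [f] is compared with it directly. *)
Lemma growth_bound_with_length (f df : R -> R) (A a : R) (N : nat) :
  1 <= A <= a ->
  (forall t, A <= t <= a -> is_derive f t (df t) /\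
     df t <= Cmod (zeta (critical_point t)) ^ 2) ->
  f a <= f A + 3 * (2 * sqrt (INR (S N)) * a + 12 * (INR (S N) * sqrt (INR (S N)))
                    + INR (S N) + 16384 * a ^ 3 / INR (S N)).
Proof.
intros HA H; destruct (dirichlet_poly_sq_primitive N) as [P [D B]].
assert (Hm := INR_S_pos N); set (m := INR (S N)) in *.
assert (K : 3 * (P A - m * / A + 16384 * a ^ 2 / m * A) - f A
   <= 3 * (P a - m * / a + 16384 * a ^ 2 / m * a) - f a).
  apply (nondecreasing_of_derive (fun t => 3 * (P t - m * / t + 16384 * a ^ 2 / m * t) - f t)
    (fun t => 3 * (dirichlet_poly_sq N t - m * (- / t ^ 2) + 16384 * a ^ 2 / m * 1) - df t)); [lra|].
  intros t Ht; destruct (H t Ht) as [Df Lf]; split.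
  - apply (is_derive_minus (fun t => 3 * (P t - m * / t + 16384 * a ^ 2 / m * t)) f); [|exact Df].
    apply (is_derive_scal (fun t => P t - m * / t + 16384 * a ^ 2 / m * t)).
    apply (is_derive_plus (fun t => P t - m * / t) (fun t => 16384 * a ^ 2 / m * t)).
    + apply (is_derive_minus P (fun t => m * / t)); [apply D|].
      auto_derive; [lra|field; lra].
    + apply (is_derive_scal (fun t => t)), (is_derive_id (K := R_AbsRing)).
  - assert (Z := zeta_critical_bound N t ltac:(lra)); fold m in Z.
    assert (16384 * t ^ 2 / m <= 16384 * a ^ 2 / m).
      apply Rmult_le_compat_r; [apply Rlt_le, Rinv_0_lt_compat, Hm|].
      apply Rmult_le_compat_l; [lra|apply pow_incr; lra].
    replace (m / t ^ 2) with (m * / t ^ 2) in Z by reflexivity.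
    lra.
assert (B' := B A a ltac:(lra)).
assert (I1 : m * / A <= m).
  rewrite <- (Rmult_1_r m) at 2; apply Rmult_le_compat_l; [lra|].
  rewrite <- Rinv_1; apply Rinv_le_contravar; lra.
assert (I2 : 0 <= m * / a)
  by (apply Rmult_le_pos; [lra|apply Rlt_le, Rinv_0_lt_compat; lra]).
assert (I3 : 0 <= 16384 * a ^ 2 / m * A).
  apply Rmult_le_pos; [|lra]; apply Rmult_le_pos; [|apply Rlt_le, Rinv_0_lt_compat, Hm].
  apply Rmult_le_pos; [lra|apply pow2_ge_0].
assert (I4 : 0 <= 2 * sqrt m * A).
  apply Rmult_le_pos; [|lra]; assert (X := sqrt_pos m); lra.
replace (16384 * a ^ 3 / m) with (16384 * a ^ 2 / m * a) by (field; lra).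
lra.
Qed.

(** The exponent [9/5] is what balances [N^(3/2)] against [a^3 / N], at
    [N ~ a^(6/5)]. *)
Lemma growth_bound (f df : R -> R) (A a : R) :
  1 <= A <= a ->
  (forall t, A <= t <= a -> is_derive f t (df t) /\
     df t <= Cmod (zeta (critical_point t)) ^ 2) ->
  f a <= f A + 50000 * exp (9 / 5 * ln a).
Proof.
intros HA H; assert (L := ln_nonneg a ltac:(lra)).
set (X := exp (6 / 5 * ln a)).
assert (HX : 1 <= X).
  unfold X; rewrite <- exp_0; apply exp_le, Rmult_le_pos; lra.
destruct (nfloor_ex X ltac:(lra)) as [N [N1 N2]].
eapply Rle_trans; [apply (growth_bound_with_length f df A a N HA H)|].
assert (Hm : X <= INR (S N) <= 2 * X) by (rewrite S_INR; lra).
set (m := INR (S N)) in *.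
(* [X = a^(6/5)] and [Y = a^(3/5)]: every term of the bound is at most a
   constant times [X * Y = a^(9/5)]. *)
set (Y := exp (3 / 5 * ln a)); assert (HY := exp_pos (3 / 5 * ln a)); fold Y in HY.
assert (XY : X = Y * Y) by (unfold X, Y; rewrite <- exp_plus; f_equal; field).
assert (HY1 : 1 <= Y).
  unfold Y; rewrite <- exp_0; apply exp_le, Rmult_le_pos; lra.
assert (Sm : sqrt m <= 2 * Y).
  rewrite <- (sqrt_square (2 * Y)) by lra; apply sqrt_le_1_alt; lra.
assert (S0 := sqrt_pos m).
replace (exp (9 / 5 * ln a)) with (X * Y)
  by (unfold X, Y; rewrite <- exp_plus; f_equal; field).
assert (aX : a <= X).
  rewrite <- (exp_ln a) at 1 by lra; unfold X; apply exp_le; lra.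
assert (a3 : a ^ 3 = X * (X * Y)).
  rewrite <- (exp_ln a) at 1 by lra; unfold X, Y; simpl.
  rewrite Rmult_1_r, <- !exp_plus; f_equal; field.
assert (T1 : sqrt m * a <= 2 * Y * X) by (apply Rmult_le_compat; lra).
assert (T2 : m * sqrt m <= 2 * X * (2 * Y)) by (apply Rmult_le_compat; lra).
assert (T3 : X * 1 <= X * Y) by (apply Rmult_le_compat_l; lra).
assert (T4 : a ^ 3 / m <= X * Y).
  apply (Rmult_le_reg_r m); [lra|].
  replace (a ^ 3 / m * m) with (X * (X * Y)) by (rewrite a3; field; lra).
  rewrite Rmult_comm; apply Rmult_le_compat_l; [apply Rmult_le_pos; lra|lra].
replace (16384 * a ^ 3 / m) with (16384 * (a ^ 3 / m)) by (field; lra).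
lra.
Qed.

(** * The substitution along the ladder *)

(** A derivative [dg] may fail to be integrable, so the two sides are compared
    as functions of the upper bound, through their derivatives. *)
Lemma RInt_comp_ge (F w g dg : R -> R) (a0 a b L : R) :
  a0 < a <= b ->
  (forall y, continuous F y) -> (forall y, 0 <= F y) ->
  (forall t, a0 < t -> continuous w t) ->
  (forall t, a0 < t -> is_derive g t (dg t)) ->
  (forall t, a <= t <= b -> L * dg t <= w t) ->
  L * RInt F (g a) (g b) <= RInt (fun t => F (g t) * w t) a b.
Proof.
intros Hab CF PF Cw Dg Hw.
assert (Cg : forall t, a0 < t -> continuous (fun t => F (g t) * w t) t).
  intros t Ht; apply (continuous_mult (K := R_AbsRing) (fun t => F (g t)) w); [|now apply Cw].
  apply continuous_comp; [|apply CF].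
  apply (ex_derive_continuous (K := R_AbsRing) (V := R_NormedModule)); exists (dg t); now apply Dg.
assert (M : RInt (fun t => F (g t) * w t) a a - L * RInt F (g a) (g a)
  <= RInt (fun t => F (g t) * w t) a b - L * RInt F (g a) (g b)).
2:{ rewrite 2!RInt_point in M; change zero with 0 in M; lra. }
apply (nondecreasing_of_derive
  (fun x => RInt (fun t => F (g t) * w t) a x - L * RInt F (g a) (g x))
  (fun x => F (g x) * w x - L * (dg x * F (g x)))); [lra|].
intros x Hx; split.
- apply (is_derive_minus (fun x => RInt (fun t => F (g t) * w t) a x)
           (fun x => L * RInt F (g a) (g x))).
  + apply (is_derive_RInt (fun t => F (g t) * w t) _ a); [|apply Cg; lra].
    apply (locally_interval _ x a0 p_infty); simpl; [lra|easy|].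
    intros y Hy _; apply (RInt_correct (V := R_CompleteNormedModule)),
      (ex_RInt_continuous (V := R_CompleteNormedModule)).
    intros z Hz; apply Cg.
    unfold Rmin in Hz; destruct Rle_dec; lra.
  + apply (is_derive_scal (fun x => RInt F (g a) (g x))).
    apply (is_derive_comp (fun y => RInt F (g a) y) g); [|apply Dg; lra].
    apply (is_derive_RInt F _ (g a)); [|apply CF].
    apply filter_forall; intros y.
    apply (RInt_correct (V := R_CompleteNormedModule)),
      (ex_RInt_continuous (V := R_CompleteNormedModule)).
    intros z _; apply CF.
- replace (F (g x) * w x - L * (dg x * F (g x)))
    with (F (g x) * (w x - L * dg x)) by ring.
  apply Rmult_le_pos; [apply PF|]; assert (H := Hw x Hx); lra.
Qed.

Lemma ln_ln_div_ln_small (K T e : R) :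
  0 < e -> exists A, T <= A /\ 1 <= A /\
    forall t, A <= t -> 2 <= ln t /\ K * (ln (ln t) / ln t) <= e.
Proof.
intros He.
assert (Hd : 0 < e / (Rabs K + 1)).
  apply Rdiv_lt_0_compat; [exact He|]; assert (H := Rabs_pos K); lra.
destruct (proj2 (is_lim_spec _ _ _) is_lim_div_ln_p (mkposreal _ Hd)) as [X HX].
simpl in HX.
set (Y := Rmax 2 (X + 1)).
exists (Rmax T (exp Y)); split; [apply Rmax_l|split].
  apply Rle_trans with (exp Y); [|apply Rmax_r].
  rewrite <- exp_0; apply exp_le; unfold Y; assert (H := Rmax_l 2 (X + 1)); lra.
intros t Ht.
assert (L : Y <= ln t).
  rewrite <- (ln_exp Y); apply ln_le; [apply exp_pos|].
  eapply Rle_trans; [apply Rmax_r|exact Ht].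
assert (Y2 := Rmax_l 2 (X + 1)); assert (YX := Rmax_r 2 (X + 1)); fold Y in Y2, YX.
split; [lra|].
assert (H := HX (ln t) ltac:(lra)); rewrite Rminus_0_r in H.
eapply Rle_trans; [apply Rle_abs|]; rewrite Rabs_mult.
assert (P := Rabs_pos K); assert (Q := Rabs_pos (ln (ln t) / ln t)).
apply Rle_trans with ((Rabs K + 1) * (e / (Rabs K + 1))).
  apply Rmult_le_compat; lra.
right; field; lra.
Qed.

Lemma ladder_derivative_bounds (phi : R -> R) (T0 : R) :
  ladder_derivative_formula phi T0 ->
  exists A, T0 <= A /\ 1 <= A /\ forall t, A <= t ->
    2 <= ln t /\ 0 <= Derive (ladder1 phi) t /\
    19 / 20 * ln t * Derive (ladder1 phi) t <= Cmod (zeta (critical_point t)) ^ 2.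
Proof.
intros [_ (eps & K & T1 & H)].
destruct (ln_ln_div_ln_small K (Rmax T0 T1) (1 / 20) ltac:(lra)) as (A & HA & A1 & S).
exists A; split; [eapply Rle_trans; [apply Rmax_l|exact HA]|split; [exact A1|]].
intros t Ht; destruct (S t Ht) as [L E].
destruct (H t) as [B D].
  eapply Rle_trans; [|exact Ht]; eapply Rle_trans; [apply Rmax_r|exact HA].
split; [exact L|].
assert (B' : Rabs (eps t) <= 1 / 20) by lra.
apply Rabs_le_between in B'.
assert (W := pow2_ge_0 (Cmod (zeta (critical_point t)))).
assert (G : 19 / 20 * ln t <= (1 + eps t) * ln t) by (apply Rmult_le_compat_r; lra).
rewrite D; split.
- apply Rmult_le_pos; [exact W|apply Rlt_le, Rinv_0_lt_compat; lra].
- set (w := Cmod (zeta (critical_point t)) ^ 2) in *; set (q := (1 + eps t) * ln t) in *.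
  replace w with (q * (w / q)) at 2 by (field; lra).
  apply Rmult_le_compat_r; [|exact G].
  apply Rmult_le_pos; [exact W|apply Rlt_le, Rinv_0_lt_compat; lra].
Qed.

(** [19/10] leaves room to absorb the multiplicative constant of the bound
    [O(a^(9/5))], and matches [19/20] in [ladder_derivative_bounds]: together they
    give [ln (phi_1 a) / 2 <= 19/20 ln a <= (1 + eps) ln t]. *)
Lemma ladder_ln_bound (phi : R -> R) (T0 : R) :
  ladder_derivative_formula phi T0 ->
  exists A, T0 <= A /\ forall a, A <= a -> 0 < ladder1 phi a ->
    ln (ladder1 phi a) <= 19 / 10 * ln a.
Proof.
intros H; destruct (ladder_derivative_bounds phi T0 H) as (A & HA & A1 & B).
destruct H as [D _].
set (C := Rabs (ladder1 phi A) + 50000).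
assert (HC : 1 <= C) by (unfold C; assert (P := Rabs_pos (ladder1 phi A)); lra).
exists (Rmax A (exp (10 * ln C))); split; [eapply Rle_trans; [exact HA|apply Rmax_l]|].
intros a Ha Pa.
assert (Aa : A <= a) by (eapply Rle_trans; [apply Rmax_l|exact Ha]).
assert (La : 10 * ln C <= ln a).
  rewrite <- (ln_exp (10 * ln C)); apply ln_le; [apply exp_pos|].
  eapply Rle_trans; [apply Rmax_r|exact Ha].
assert (La0 := ln_nonneg a ltac:(lra)).
assert (G : ladder1 phi a <= C * exp (9 / 5 * ln a)).
  eapply Rle_trans.
    apply (growth_bound (ladder1 phi) (Derive (ladder1 phi)) A a); [lra|].
    intros t Ht; destruct (B t ltac:(lra)) as (L & P & W); split.
      apply Derive_correct, D; lra.
    eapply Rle_trans; [|exact W].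
    rewrite <- (Rmult_1_l (Derive _ _)) at 1; apply Rmult_le_compat_r; lra.
  unfold C; rewrite Rmult_plus_distr_r; apply Rplus_le_compat_r.
  eapply Rle_trans; [apply Rle_abs|].
  rewrite <- (Rmult_1_r (Rabs _)) at 1; apply Rmult_le_compat_l; [apply Rabs_pos|].
  rewrite <- exp_0; apply exp_le; lra.
apply ln_le in G; [|exact Pa].
rewrite ln_mult, ln_exp in G by (try apply exp_pos; lra); lra.
Qed.

(** Applied to the ladder, this shows that a large value [T] has only large
    preimages. *)
Lemma differentiable_bounded_above (f : R -> R) (T0 A : R) :
  T0 <= A -> (forall t, T0 <= t -> ex_derive f t) ->
  exists M, forall t, T0 <= t <= A -> f t <= M.
Proof.
intros HA D.
destruct (continuity_ab_maj f T0 A HA) as [x [Hx _]].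
- intros t Ht; apply continuity_pt_filterlim.
  apply (ex_derive_continuous (K := R_AbsRing) (V := R_NormedModule)), D; lra.
- exists (f x); exact Hx.
Qed.

Theorem theorem1 (r : nat) (B c : R) (hB : 0 < B) (hc : 0 < c)
  (hRam : ramachandra_inequality r B c)
  (mu : R -> R) (y0 : R) (phi : R -> R) (T0 : R)
  (hphi : is_jacob_ladder mu y0 phi T0)
  (hder : ladder_derivative_formula phi T0) :
  exists T1 : R, forall T U : R, T1 <= T ->
    3 * Rpower (ln T) c <= U <= T / ln T ->
    forall a b : R, T0 <= a -> a < b ->
      maps_segment_onto (ladder1 phi) a b T (T + U) ->
      RInt (fun t => Cmod (zeta_deriv r (critical_point (ladder1 phi t)))
                     * Cmod (zeta (critical_point t)) ^ 2) a b
        > B / 2 * U * Rpower (ln U) (INR r + 1 / 4) * ln T.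
Proof.
destruct (ladder_derivative_bounds phi T0 hder) as (A1 & HA1 & A1' & Bd).
destruct (ladder_ln_bound phi T0 hder) as (A2 & HA2 & Ln).
destruct hder as [D _].
set (A := Rmax A1 A2).
assert (E1 : A1 <= A) by apply Rmax_l; assert (E2 : A2 <= A) by apply Rmax_r.
destruct (differentiable_bounded_above (ladder1 phi) T0 A ltac:(lra) D) as [M HM].
destruct hRam as [T2 Ram].
exists (Rmax (M + 1) (Rmax T2 (exp 1))).
intros T U HT HU a b Ha Hab Onto.
assert (TM : M + 1 <= T) by (eapply Rle_trans; [apply Rmax_l|exact HT]).
assert (TT : T2 <= T).
  eapply Rle_trans; [|exact HT]; eapply Rle_trans; [apply Rmax_l|apply Rmax_r].
assert (Te : exp 1 <= T).
  eapply Rle_trans; [|exact HT]; eapply Rle_trans; [apply Rmax_r|apply Rmax_r].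
assert (T1 : 0 < T) by (assert (X := exp_pos 1); lra).
assert (LT : 1 <= ln T) by (rewrite <- (ln_exp 1); apply ln_le; [apply exp_pos|exact Te]).
assert (U0 : 0 < U) by (assert (X := exp_pos (c * ln (ln T))); fold (Rpower (ln T) c) in X; lra).
assert (U2 : U <= 2 * T).
  apply Rle_trans with (T / ln T); [lra|].
  assert (/ ln T <= / 1) by (apply Rinv_le_contravar; lra).
  rewrite Rinv_1 in *; unfold Rdiv.
  assert (T * / ln T <= T * 1) by (apply Rmult_le_compat_l; lra); lra.
assert (Range : forall t, a <= t <= b -> T <= ladder1 phi t <= T + U).
  intros t Ht; apply Onto; now exists t.
(* The ladder cannot reach [T] on [[T0, A]]. *)
assert (Aa : A < a).
  destruct (Rlt_le_dec A a) as [?|N]; [assumption|].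
  assert (X := Range a ltac:(lra)); assert (Y := HM a ltac:(lra)); lra.
assert (Mono : forall x y, a <= x -> x <= y -> ladder1 phi x <= ladder1 phi y).
  intros x y Hx Hxy.
  apply (nondecreasing_of_derive (ladder1 phi) (Derive (ladder1 phi))); [exact Hxy|].
  intros t Ht; split; [apply Derive_correct, D; lra|apply Bd; lra].
assert (Va : ladder1 phi a = T).
  destruct (proj2 (Onto T) ltac:(lra)) as [t [Ht Et]].
  assert (X := Range a ltac:(lra)); assert (Y := Mono a t ltac:(lra) ltac:(lra)); lra.
assert (Vb : ladder1 phi b = T + U).
  destruct (proj2 (Onto (T + U)) ltac:(lra)) as [t [Ht Et]].
  assert (X := Range b ltac:(lra)); assert (Y := Mono t b ltac:(lra) ltac:(lra)); lra.
assert (LL := Ln a ltac:(lra) ltac:(lra)); rewrite Va in LL.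
assert (R1 := Ram T U TT ltac:(lra)).
assert (CV := RInt_comp_ge (fun y => Cmod (zeta_deriv r (critical_point y)))
  (fun t => Cmod (zeta (critical_point t)) ^ 2) (ladder1 phi) (Derive (ladder1 phi))
  A a b (19 / 20 * ln a)).
rewrite Va, Vb in CV.
set (J := RInt (fun y => Cmod (zeta_deriv r (critical_point y))) T (T + U)) in *.
assert (P : 0 < B * U * Rpower (ln U) (INR r + 1 / 4)).
  repeat apply Rmult_lt_0_compat; try assumption; apply exp_pos.
apply Rlt_gt; eapply Rlt_le_trans; [|apply CV].
- replace (B / 2 * U * Rpower (ln U) (INR r + 1 / 4) * ln T)
    with (ln T / 2 * (B * U * Rpower (ln U) (INR r + 1 / 4))) by field.
  apply Rlt_le_trans with (ln T / 2 * J).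
    apply Rmult_lt_compat_l; lra.
  apply Rmult_le_compat_r; lra.
- lra.
- intros y; apply zeta_deriv_continuous.
- intros y; apply Cmod_ge_0.
- intros t _.
  apply (continuous_comp (fun t => Cmod (zeta (critical_point t))) (fun x => x ^ 2)).
    apply (zeta_deriv_continuous 0).
  apply (ex_derive_continuous (K := R_AbsRing) (V := R_NormedModule)); auto_derive; easy.
- intros t Ht; apply Derive_correct, D; lra.
- intros t Ht; destruct (Bd t ltac:(lra)) as (L & Dt & W).
  eapply Rle_trans; [|exact W]; apply Rmult_le_compat_r; [exact Dt|].
  assert (ln a <= ln t) by (apply ln_le; lra); lra.
Qed.
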